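(* Let $p\in(1,\infty)$. There is a constant $C>0$ depending only on $p$ such that for every $b\in L^1_{\mathrm{loc}}(\mathbb{R}^2;\mathbb{C})$, $$\|b\|_{\mathrm{BMO}_\gamma(\mathbb{R}^2)}\le C\,\|[b,H_\gamma]\|_{L^p(\mathbb{R}^2)\to L^p(\mathbb{R}^2)},$$ where $\gamma(t)=(t,t^2)$, $H_\gamma$ is the parabolic Hilbert transform and $[b,H_\gamma]$ is its commutator with multiplication by $b$.
   Context: For $f:\mathbb{R}^2\to\mathbb{C}$, the parabolic Hilbert transform is $H_\gamma f(x)=\mathrm{p.v.}\int_{\mathbb{R}} f(x-\gamma(t))\,\frac{dt}{t}$ with $\gamma(t)=(t,t^2)$, and the commutator is $[b,H_\gamma]f(x)=b(x)H_\gamma f(x)-H_\gamma(bf)(x)$. $\|[b,H_\gamma]\|_{L^p\to L^p}$ is its operator norm (equal to $+\infty$ if it is not bounded). $\mathcal{R}_\gamma$ is the collection of parabolic rectangles: rectangles $Q=I\times J\subset\mathbb{R}^2$ ($I,J$ bounded intervals of positive length, sides parallel to the coordinate axes) with $\ell(J)=\ell(I)^2$, where $\ell$ denotes length. With $\langle b\rangle_Q=\frac1{|Q|}\int_Q b$, define $$\|b\|_{\mathrm{BMO}_\gamma(\mathbb{R}^2)}=\sup_{Q\in\mathcal{R}_\gamma}\frac{1}{|Q|}\int_Q|b-\langle b\rangle_Q|.$$ *)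

(* Defs.v *)
From HB Require Import structures.
From mathcomp Require Import all_boot all_order all_algebra.
From mathcomp Require Import complex.
From mathcomp Require Import all_classical all_reals all_analysis.

Set Implicit Arguments.
Unset Strict Implicit.
Unset Printing Implicit Defensive.

Import Order.TTheory GRing.Theory Num.Theory.
Import numFieldNormedType.Exports.

Local Open Scope classical_set_scope.
Local Open Scope ring_scope.
Local Open Scope complex_scope.

Section ComplexValued.
Context (d : measure_display) (T : measurableType d) (R : realType).
Implicit Types (mu : {measure set T -> \bar R}) (D : set T) (f : T -> R[i]).

Definition cmeasurable f : Prop :=
  measurable_fun [set: T] (fun x => complex.Re (f x)) /\
  measurable_fun [set: T] (fun x => complex.Im (f x)).

Definition cintegrable mu D f : Prop :=
  mu.-integrable D (fun x => (complex.Re (f x))%:E) /\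
  mu.-integrable D (fun x => (complex.Im (f x))%:E).

Definition cintegral mu D f : R[i] :=
  (\int[mu]_(x in D) complex.Re (f x)) +i* (\int[mu]_(x in D) complex.Im (f x)).

Definition cLnorm mu (p : R) f : \bar R :=
  Lnorm mu p%:E (fun x => (Normc.normc (f x))%:E).

Definition in_Lp mu (p : R) f : Prop :=
  cmeasurable f /\ (cLnorm mu p f < +oo)%E.

(* [S f x] is meaningful only where [defined f x] holds.  An operator that is
   undefined on a non-negligible set for some [f] in L^p admits no bound [N],
   and the infimum of the empty set of bounds is [+oo]. *)
Definition Lp_opnorm mu (p : R) (defined : (T -> R[i]) -> T -> Prop)
    (S : (T -> R[i]) -> T -> R[i]) : \bar R :=
  ereal_inf [set N%:E | N in [set N : R | 0 <= N /\
    forall f, in_Lp mu p f ->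
      {ae mu, forall x, defined f x} /\
      (cLnorm mu p (S f) <= N%:E * cLnorm mu p f)%E]].

End ComplexValued.

Section PrincipalValue.
Context (R : realType).
Implicit Types (g : R -> R[i]) (eps : R).

Definition truncated_integral g eps : R[i] :=
  cintegral (@lebesgue_measure R) [set t | eps < `|t|] g.

Definition pv_exists g : Prop :=
  [/\ forall eps, 0 < eps ->
        cintegrable (@lebesgue_measure R) [set t | eps < `|t|] g,
      cvg (complex.Re (truncated_integral g eps) @[eps --> 0^'+]) &
      cvg (complex.Im (truncated_integral g eps) @[eps --> 0^'+])].

(* Principal value at the origin; meaningful only when [pv_exists g]. *)
Definition pv g : R[i] :=
  lim (complex.Re (truncated_integral g eps) @[eps --> 0^'+]) +i*
  lim (complex.Im (truncated_integral g eps) @[eps --> 0^'+]).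

End PrincipalValue.

Section Parabola.
Context (R : realType).
(* [plane] is [R * R] with the Borel sigma-algebra on which Lebesgue measure is
   defined.  Working with Borel functions is no restriction: a Lebesgue
   measurable function agrees almost everywhere with a Borel one. *)
Local Notation plane := (measurableTypeR R * measurableTypeR R)%type.
Implicit Types (b f : R * R -> R[i]) (x : R * R) (Q : set (R * R)).

Definition plane_measure : {measure set plane -> \bar R} :=
  (@lebesgue_measure R \x @lebesgue_measure R)%E.

Definition locally_integrable_plane b : Prop :=
  @cmeasurable _ plane R b /\
  forall K : set (R * R), compact K -> cintegrable plane_measure K b.

Definition parabola (t : R) : R * R := (t, t ^+ 2).

Definition hilbert_kernel f x : R -> R[i] :=
  fun t => f (x - parabola t) / t%:C.

Definition hilbert_defined f x : Prop := pv_exists (hilbert_kernel f x).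

Definition parabolic_hilbert f x : R[i] := pv (hilbert_kernel f x).

Definition commutator_defined b f x : Prop :=
  hilbert_defined f x /\ hilbert_defined (fun y => b y * f y) x.

Definition hilbert_commutator b f x : R[i] :=
  b x * parabolic_hilbert f x - parabolic_hilbert (fun y => b y * f y) x.

Definition commutator_norm (p : R) b : \bar R :=
  Lp_opnorm plane_measure p (commutator_defined b) (hilbert_commutator b).

(* The booleans say, for each of the four endpoints, whether it belongs to its
   interval, so that all bounded intervals of positive length are covered. *)
Definition parabolic_rectangles : set (set (R * R)) :=
  [set Q | exists (a1 a2 c1 c2 : R) (s1 s2 r1 r2 : bool),
    [/\ a1 < a2, c1 < c2, c2 - c1 = (a2 - a1) ^+ 2 &
        Q = [set` Interval (BSide s1 a1) (BSide s2 a2)] `*`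
            [set` Interval (BSide r1 c1) (BSide r2 c2)]]].

Definition mean b Q : R[i] :=
  ((fine (plane_measure Q))^-1)%:C * cintegral plane_measure Q b.

Definition mean_oscillation b Q : \bar R :=
  (((fine (plane_measure Q))^-1)%:E *
   \int[plane_measure]_(x in Q) (Normc.normc (b x - mean b Q))%:E)%E.

Definition BMO_norm b : \bar R :=
  ereal_sup [set mean_oscillation b Q | Q in parabolic_rectangles].

End Parabola.

(* Main.v *)
(** A commutator bound [N] controls every form
    [int b (g * T f - f * T' g)], where [T f x] integrates [f (x - (t, t^2)) / t]
    over [t] near [100 lam], [T'] is its adjoint, and [f], [g] are bounded by the
    indicators of two sets [D], [E] that are separated at the scale [lam], so that
    the principal value plays no role.  Transporting a density [phi] on [D] to [E]
    by [g * T (phi / T' g)] and back to [D] by the adjoint recipe, with [f] and [g]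
    the indicators, gives a Markov operator [P] on [D] that is reversible with
    respect to the weight [w = f * T' g], and [int b phi] differs from
    [int b (P phi)] by at most twice the bound.

    A step along [(t, t^2)] followed by a step back along [(s, s^2)] is the
    displacement [(t - s, (t - s) (t + s))]; at fixed [t - s] it moves the second
    coordinate with density [1 / (2 |t - s|)].  Hence, when [D] is a parallelogram
    whose long sides have slope [200 lam], [P] charges uniformly all points of [D]
    outside a thin vertical strip.  On functions of integral zero dominated by [w],
    [P] is therefore a strict contraction for the norm [sup |phi| / w], and the
    supremum of [int b phi] over the unit ball is absorbed: it is finite because
    [b] is locally integrable, and at most a constant times [N].  Applied to the
    sign of [b - mean b Q], this bounds the mean oscillation on a rectangle [Q]
    inside [D]; the real and imaginary parts of [b] are treated separately. *)
Require Import Defs.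
From HB Require Import structures.
From mathcomp Require Import all_boot all_order all_algebra.
From mathcomp Require Import complex.
From mathcomp Require Import all_classical all_reals all_analysis.
From mathcomp Require Import measurable_realfun lra ring.

Set Implicit Arguments.
Unset Strict Implicit.
Unset Printing Implicit Defensive.

Import Order.TTheory GRing.Theory Num.Theory.
Import numFieldNormedType.Exports.
Local Open Scope classical_set_scope.
Local Open Scope ring_scope.

(** * Translation and affine invariance of Lebesgue measure *)

Section Affine.
Context (R : realType).
Local Notation mu := (@lebesgue_measure R).
Local Notation line := (measurableTypeR R).

Lemma measurable_affine (u v : R) :
  measurable_fun [set: line] ((fun t => u + v * t) : line -> line).
Proof.
by apply: measurable_funD => //; apply: measurable_funM.
Qed.

(** By uniqueness of Lebesgue measure, the scaled pushforward need only be compared with it on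
    half-open intervals. For [v < 0] the preimage is half-open on the other side, with the same
    length formula. *)
Lemma lebesgue_measure_affine (u v : R) (A : set line) : v != 0 -> measurable A ->
  mu A = (`|v|%:E * mu ((fun t => u + v * t)%R @^-1` A))%E.
Proof.
move=> v0 mA.
have v0' : 0 <= `|v| by [].
have mm := measurable_affine u v.
pose m := mscale (NngNum v0') (pushforward mu ((fun t => u + v * t) : line -> line)).
have -> : mu A = m mm A; last by [].
apply: lebesgue_measure_unique => // _ [[a b]] _ <-.
transitivity (`|v|%:E * mu ((fun t : line => u + v * t)%R @^-1` [set` `]a, b]]))%E; last by [].
have [vp|vn] := ltrP 0 v.
- rewrite (_ : (fun t : line => _) @^-1` _ = [set` `](v^-1 * (a - u)), (v^-1 * (b - u))]]); last first.
    by apply/seteqP; split => t /=; rewrite !in_itv/= ![v^-1 * _]mulrC ltr_pdivrMr// ler_pdivlMr//; move=> /andP[h1 h2]; apply/andP; split; lra.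
  rewrite !lebesgue_measure_itv/= !lte_fin ltr_pM2l ?invr_gt0// ltrD2r.
  case: ifPn => _; last by rewrite mule0.
  by rewrite -!EFinB -EFinM gtr0_norm//; congr (_%:E); field.
- have {}vn : v < 0 by rewrite lt_neqAle v0.
  rewrite (_ : (fun t : line => _) @^-1` _ = [set` `[(v^-1 * (b - u)), (v^-1 * (a - u))[]); last first.
    by apply/seteqP; split => t /=; rewrite !in_itv/= ![v^-1 * _]mulrC ler_ndivrMr// ltr_ndivlMr//; move=> /andP[h1 h2]; apply/andP; split; lra.
  rewrite !lebesgue_measure_itv/= !lte_fin ltr_nM2l ?invr_lt0// ltrD2r.
  case: ifPn => _; last by rewrite mule0.
  by rewrite -!EFinB -EFinM ltr0_norm//; congr (_%:E); field.
Qed.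

Lemma ge0_integral_affine (u v : R) (F : line -> \bar R) : v != 0 ->
  measurable_fun setT F -> (forall t, 0 <= F t)%E ->
  (\int[mu]_t F t = `|v|%:E * \int[mu]_t F (u + v * t)%R)%E.
Proof.
move=> v0 mF F0.
have v0' : 0 <= `|v| by [].
have mm := measurable_affine u v.
have := @ge0_integral_pushforward _ _ line line R _ mm mu setT F measurableT mF.
rewrite preimage_setT => <- //.
rewrite -(@ge0_integral_mscale _ line R _ setT measurableT (NngNum v0') F)//.
by apply: eq_measure_integral => A mA _; exact: lebesgue_measure_affine.
Qed.

End Affine.

(** * Measurability of partial integrals *)

Section Fubini_aux.
Context d1 d2 (T1 : measurableType d1) (T2 : measurableType d2) (R : realType).
Variable m2 : {sigma_finite_measure set T2 -> \bar R}.

(** Tonelli's theorem treats the positive and the negative part, and the integral is the difference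
    of the two integrals. *)
Lemma measurable_partial_integral (f : T1 * T2 -> \bar R) :
  measurable_fun setT f ->
  measurable_fun setT (fun x => \int[m2]_y f (x, y))%E.
Proof.
move=> mf.
rewrite (_ : (fun _ => _) = (fun x => \int[m2]_y (f^\+)%E (x, y)) \-
    (fun x => \int[m2]_y (f^\-)%E (x, y)))%E.
  apply: emeasurable_funB; apply: measurable_fun_fubini_tonelli_F => //.
  - exact: measurable_funepos.
  - exact: measurable_funeneg.
apply/funext=> x; rewrite [LHS]integralE.
under eq_integral do rewrite funepos_comp/=.
by under [X in (_ - X = _)%E]eq_integral do rewrite funeneg_comp/=.
Qed.

End Fubini_aux.

(** * The algebra of bounded measurable functions *)

Definition bounded_measurable d (T : measurableType d) (R : realType) (f : T -> R) :=
  measurable_fun [set: T] f /\ exists M, forall x, `|f x| <= M.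

Section Bounded_measurable.
Context d (T : measurableType d) (R : realType) (m : {measure set T -> \bar R}).
Implicit Types f g : T -> R.
Local Notation bm := (@bounded_measurable d T R).

Lemma bmD f g : bm f -> bm g -> bm (fun x => f x + g x).
Proof.
move=> [mf [M fM]] [mg [N gN]]; split; first exact: measurable_funD.
exists (M + N) => x; apply: (le_trans (ler_normD _ _)); exact: lerD.
Qed.

Lemma bmM f g : bm f -> bm g -> bm (fun x => f x * g x).
Proof.
move=> [mf [M fM]] [mg [N gN]]; split; first exact: measurable_funM.
by exists (M * N) => x; rewrite normrM; apply: ler_pM.
Qed.

Lemma bm_cst (c : R) : bm (fun=> c).
Proof. by split; [exact: measurable_cst|exists `|c|]. Qed.

Lemma bmB f g : bm f -> bm g -> bm (fun x => f x - g x).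
Proof.
move=> bf bg; rewrite (_ : (fun _ => _) = fun x => f x + (- 1) * g x); last first.
  by apply/funext => x; rewrite mulN1r.
by apply: bmD => //; apply: bmM => //; exact: bm_cst.
Qed.

Lemma bm_indic (A : set T) : measurable A -> bm (\1_A : T -> R).
Proof.
move=> mA; split; first exact: measurable_indic.
by exists 1 => x; rewrite indicE; case: (_ \in _) => /=; rewrite ?normr1 ?normr0.
Qed.

Lemma bm_dominated f g : measurable_fun setT f -> bm g -> (forall x, `|f x| <= g x) -> bm f.
Proof.
move=> mf [_ [M gM]] fg; split=> //; exists M => x.
by apply: (le_trans (fg x)); apply: le_trans (gM x); exact: ler_norm.
Qed.

Lemma integrable_bmM f g : bm f -> m.-integrable setT (EFin \o g) ->
  m.-integrable setT (EFin \o (fun x => f x * g x)).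
Proof.
move=> [mf [M fM]] ig.
have := @integrableMr _ _ _ m setT measurableT f (EFin \o g).
apply=> //; exists M; split; first by apply: num_real.
by move=> y My x _ /=; apply: (le_trans (fM x)); exact: ltW.
Qed.

Lemma integrable_Mbm f g : m.-integrable setT (EFin \o f) -> bm g ->
  m.-integrable setT (EFin \o (fun x => f x * g x)).
Proof.
move=> i b; rewrite (_ : (fun _ => _) = fun x => g x * f x); first exact: integrable_bmM.
by apply/funext => x; rewrite mulrC.
Qed.

(** On nonnegative reals the inverse is the power with exponent [-1]; at [0] both take the value
    [0]. *)
Lemma measurable_funV f : measurable_fun setT f -> (forall x, 0 <= f x) ->
  measurable_fun setT (fun x => (f x)^-1).
Proof.
move=> mf f0; rewrite (_ : (fun _ => _) = fun x => (f x) `^ (-1)).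
  exact: (measurableT_comp (measurable_powR (-1))).
by apply/funext => x; rewrite powR_inv1.
Qed.


End Bounded_measurable.

(** * Translation invariance and sigma-finiteness on the plane *)

Section Transport.
Context (R : realType).
Local Notation mu := (@lebesgue_measure R).
Local Notation line := (measurableTypeR R).
Local Notation plane := (line * line)%type.
Local Notation nu := (@plane_measure R).

Lemma measurable_shift (v : R * R) :
  measurable_fun [set: plane] ((fun x : R * R => x + v) : plane -> plane).
Proof.
apply/measurable_fun_pairP; split; rewrite /comp/=.
- by apply: measurable_funD => //; exact: measurable_fst.
- by apply: measurable_funD => //; exact: measurable_snd.
Qed.

(** A translation acts on each coordinate separately, so rectangles keep their measure, and a
    product measure is determined by its values on rectangles. *)
Lemma plane_measure_shift (v : R * R) (A : set plane) : measurable A ->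
  nu A = nu ((fun x : R * R => x + v) @^-1` A).
Proof.
move=> mA.
rewrite -[RHS]/(pushforward nu ((fun x : R * R => x + v) : plane -> plane) A).
apply: product_measure_unique => // [|m' X Y mX mY]; first exact: measurable_shift.
rewrite /= /pushforward (_ : _ @^-1` _ = ((fun t => v.1 + 1 * t)%R @^-1` X) `*` ((fun t => v.2 + 1 * t)%R @^-1` Y)); last first.
  by apply/seteqP; split => -[x1 x2] /=; rewrite !mul1r ![_.1 + x1]addrC ![_.2 + x2]addrC.
rewrite [LHS]product_measure1E.
- by rewrite [in RHS](@lebesgue_measure_affine R v.1 1)// [in X in _ = (_ * X)%E](@lebesgue_measure_affine R v.2 1)// normr1 !mul1e.
- by rewrite -[X in measurable X]setTI; exact: measurable_affine.
- by rewrite -[X in measurable X]setTI; exact: measurable_affine.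
Qed.

Lemma ge0_integral_shift (v : R * R) (F : plane -> \bar R) :
  measurable_fun setT F -> (forall x, 0 <= F x)%E ->
  (\int[nu]_x F (x + v)%R = \int[nu]_x F x)%E.
Proof.
move=> mF F0; have mm := measurable_shift v.
have := @ge0_integral_pushforward _ _ plane plane R _ mm nu setT F measurableT mF.
rewrite preimage_setT => H; apply: (etrans (esym (H _))) => [x _|]; first exact: F0.
by apply: eq_measure_integral => A mA _; rewrite [RHS](plane_measure_shift v).
Qed.

Lemma integral_shift (v : R * R) (F : plane -> \bar R) :
  nu.-integrable setT F ->
  nu.-integrable setT (fun x => F (x + v)) /\
  (\int[nu]_x F (x + v)%R = \int[nu]_x F x)%E.
Proof.
move=> iF; have mm := measurable_shift v; have mF := measurable_int _ iF.
have i' : nu.-integrable setT (fun x => F (x + v)).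
  apply/integrableP; split; first exact: measurableT_comp.
  rewrite (ge0_integral_shift v (F := fun x => `|F x|%E))//.
    by case/integrableP : iF.
  exact: measurableT_comp.
split=> //.
have := @integral_pushforward _ _ plane plane R _ mm nu setT F mF.
rewrite preimage_setT => H; apply: (etrans (esym (H i' measurableT))).
by apply: eq_measure_integral => A mA _; rewrite [RHS](plane_measure_shift v).
Qed.

Lemma sigma_finite_plane_measure : sigma_finite setT (@plane_measure R).
Proof.
have /sigma_finiteP[F [TF ndF Foo]] := sigma_finiteT (@lebesgue_measure R).
exists (fun n => F n `*` F n).
  rewrite -setXTT TF predeqE => -[x y]; split.
    move=> [/= [n _ Fnx] [k _ Fky]]; exists (maxn n k) => //; split.
    - by move: x Fnx; exact/subsetPset/ndF/leq_maxl.
    - by move: y Fky; exact/subsetPset/ndF/leq_maxr.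
  by move=> [n _ []/= ? ?]; split; exists n.
move=> k; have [? ?] := Foo k; split; first exact: measurableX.
by rewrite [X in (X < _)%E]product_measure1E// lte_mul_pinfty// ge0_fin_numE.
Qed.

(* The sigma-finite structure of a product is not inferred for
   [lebesgue_measure \x lebesgue_measure]; Fubini's theorem uses this copy. *)
Definition sf_plane_measure : set plane -> \bar R := @plane_measure R.
HB.instance Definition _ := Measure.on sf_plane_measure.
HB.instance Definition _ := Measure_isSigmaFinite.Build _ plane R sf_plane_measure sigma_finite_plane_measure.

End Transport.

(** * Averages along a curve *)

Section Curve_average.
Context (R : realType).
Local Notation mu := (@lebesgue_measure R).
Local Notation line := (measurableTypeR R).
Local Notation plane := (line * line)%type.

Definition curve_average (k : R -> R) (s : R -> R * R) (f : R * R -> R) (x : R * R) : R :=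
  \int[mu]_t (k t * f (x + s t)).

Context (k : R -> R) (s : R -> R * R).
Hypothesis ik : mu.-integrable setT (EFin \o k).
Hypothesis k0 : forall t, 0 <= k t.
Hypothesis ms : measurable_fun [set: line] (s : line -> plane).
Implicit Types f g F : R * R -> R.
Local Notation bm := (@bounded_measurable _ plane R).
Local Notation A := (curve_average k s).

Let mk : measurable_fun [set: line] (k : line -> R).
Proof. by apply/measurable_EFinP; exact: measurable_int ik. Qed.

Lemma measurable_along_curve (x : R * R) :
  measurable_fun [set: line] ((fun t => x + s t) : line -> plane).
Proof.
apply/measurable_fun_pairP; split; rewrite /comp/=.
- apply: measurable_funD => //; exact: (measurableT_comp measurable_fst).
- apply: measurable_funD => //; exact: (measurableT_comp measurable_snd).
Qed.

Lemma measurable_along_curve2 :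
  measurable_fun [set: plane * line] ((fun z : (R * R) * R => z.1 + s z.2) : plane * line -> plane).
Proof.
apply/measurable_fun_pairP; split; rewrite /comp/=.
- apply: measurable_funD.
    exact: (measurableT_comp measurable_fst measurable_fst).
  exact: (measurableT_comp measurable_fst (measurableT_comp ms measurable_snd)).
- apply: measurable_funD.
    exact: (measurableT_comp measurable_snd measurable_fst).
  exact: (measurableT_comp measurable_snd (measurableT_comp ms measurable_snd)).
Qed.

Lemma curve_integrand_integrable f x : bm f ->
  mu.-integrable setT (EFin \o (fun t => k t * f (x + s t))).
Proof.
move=> [mf [M fM]]; apply: integrable_Mbm => //; split.
  exact: (measurableT_comp mf (measurable_along_curve x)).
by exists M.
Qed.

Lemma measurable_curve_integrand f : measurable_fun [set: plane] (f : plane -> R) ->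
  measurable_fun [set: plane * line] (fun z : plane * line => k z.2 * f (z.1 + s z.2)).
Proof.
move=> mf; apply: measurable_funM; first exact: (measurableT_comp mk measurable_snd).
exact: (measurableT_comp mf measurable_along_curve2).
Qed.

Lemma measurable_curve_average f : measurable_fun [set: plane] (f : plane -> R) ->
  measurable_fun [set: plane] (A f : plane -> R).
Proof.
move=> mf; rewrite /curve_average/Rintegral.
apply: (measurableT_comp (@fine_measurable R setT measurableT)) => //.
apply: (@measurable_partial_integral _ _ plane line R mu
  (fun z : plane * line => (k z.2 * f (z.1 + s z.2))%:E)).
apply/measurable_EFinP; exact: measurable_curve_integrand.
Qed.

Lemma curve_averageD f g x : bm f -> bm g ->
  A (fun y => f y + g y) x = A f x + A g x.
Proof.
move=> bf bg; rewrite /curve_average -RintegralD//; last 2 first.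
- exact: curve_integrand_integrable.
- exact: curve_integrand_integrable.
by apply: eq_Rintegral => t _; rewrite mulrDr.
Qed.

Lemma curve_averageZ c f x : bm f -> A (fun y => c * f y) x = c * A f x.
Proof.
move=> bf; rewrite /curve_average -RintegralZl//; last exact: curve_integrand_integrable.
by apply: eq_Rintegral => t _; rewrite mulrCA.
Qed.

Lemma curve_averageB f g x : bm f -> bm g ->
  A (fun y => f y - g y) x = A f x - A g x.
Proof.
move=> bf bg; rewrite /curve_average -RintegralB//; last 2 first.
- exact: curve_integrand_integrable.
- exact: curve_integrand_integrable.
by apply: eq_Rintegral => t _; rewrite mulrBr.
Qed.

Lemma curve_average_ge0 f x : (forall y, 0 <= f y) -> 0 <= A f x.
Proof. by move=> f0; apply: Rintegral_ge0 => t _; rewrite mulr_ge0. Qed.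

Lemma ler_curve_average f g x : bm f -> bm g -> (forall y, f y <= g y) -> A f x <= A g x.
Proof.
move=> bf bg fg; rewrite -subr_ge0 -curve_averageB//.
by apply: curve_average_ge0 => y; rewrite subr_ge0.
Qed.

Lemma normr_curve_average f g x : bm f -> bm g -> (forall y, `|f y| <= g y) -> `|A f x| <= A g x.
Proof.
move=> bf bg fg; rewrite ler_norml; apply/andP; split; last first.
  by apply: ler_curve_average => // y; apply: le_trans (fg y); exact: ler_norm.
rewrite -mulN1r -curve_averageZ//; apply: ler_curve_average => //.
  by apply: bmM => //; exact: bm_cst.
by move=> y; rewrite mulN1r; have := fg y; rewrite ler_norml => /andP[].
Qed.

Lemma bm_curve_average f : bm f -> bm (A f).
Proof.
move=> bf; split; first by apply: measurable_curve_average; case: bf.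
case: (bf) => mf [M fM]; exists (M * \int[mu]_t k t) => x.
apply: (@le_trans _ _ (A (fun=> M) x)).
  by apply: normr_curve_average => //; exact: bm_cst.
rewrite /curve_average -RintegralZl//; apply: le_Rintegral => //.
- by apply: integrable_Mbm => //; exact: bm_cst.
- by apply: integrable_bmM => //; exact: bm_cst.
- by move=> t _; rewrite mulrC.
Qed.

End Curve_average.

(** * The adjoint of a curve average *)

Section Duality.
Context (R : realType).
Local Notation mu := (@lebesgue_measure R).
Local Notation line := (measurableTypeR R).
Local Notation plane := (line * line)%type.
Local Notation nu := (@plane_measure R).
Let snu : {sigma_finite_measure set plane -> \bar R} := @sf_plane_measure R.
Context (k : R -> R) (s : R -> R * R).
Hypothesis ik : mu.-integrable setT (EFin \o k).
Hypothesis k0 : forall t, 0 <= k t.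
Hypothesis ms : measurable_fun [set: line] (s : line -> plane).
Hypothesis msN : measurable_fun [set: line] ((fun t => - s t) : line -> plane).
Local Notation bm := (@bounded_measurable _ plane R).

Let mk : measurable_fun [set: line] (k : line -> R).
Proof. by apply/measurable_EFinP; exact: measurable_int ik. Qed.

(** The integrands of the two sides of the duality. At fixed [t], the measure-preserving shift by
    [s t] turns [shifted] into [sheared]. *)
Let shifted (F g : R * R -> R) : plane * line -> \bar R :=
  fun z => (g z.1 * (k z.2 * F (z.1 - s z.2)))%:E.

Let sheared (F g : R * R -> R) : plane * line -> \bar R :=
  fun z => (F z.1 * (k z.2 * g (z.1 + s z.2)))%:E.

Let measurable_shifted (F g : plane -> R) : measurable_fun setT F ->
  measurable_fun setT g -> measurable_fun setT (shifted F g).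
Proof.
move=> mF mg; apply/measurable_EFinP; apply: measurable_funM.
  exact: (measurableT_comp mg measurable_fst).
exact: (measurable_curve_integrand ik msN).
Qed.

Let measurable_sheared (F g : plane -> R) : measurable_fun setT F ->
  measurable_fun setT g -> measurable_fun setT (sheared F g).
Proof.
move=> mF mg; apply/measurable_EFinP; apply: measurable_funM.
  exact: (measurableT_comp mF measurable_fst).
exact: (measurable_curve_integrand ik ms).
Qed.

Let integrable_sheared (F g : plane -> R) : nu.-integrable setT (EFin \o F) -> bm g ->
  (snu \x mu)%E.-integrable setT (sheared F g).
Proof.
move=> iF [mg [M gM]].
have mF : measurable_fun setT F by apply/measurable_EFinP; exact: measurable_int iF.
apply: ((@integrable12ltyP _ _ plane line R snu mu _ (measurable_sheared mF mg)).2).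
have M0 : 0 <= M by apply: le_trans (gM (0, 0)).
have fk : (\int[mu]_t (k t)%:E \is a fin_num)%E by exact: integrable_fin_num.
set K := fine (\int[mu]_t (k t)%:E)%E.
apply: (@le_lt_trans _ _ (\int[snu]_y ((M * K)%:E * `|F y|%:E))%E).
  apply: ge0_le_integral => //.
  - by move=> x _; apply: integral_ge0 => t _.
  - apply: (@measurable_partial_integral _ _ plane line R mu (fun z => `|sheared F g z|)%E).
    apply: measurableT_comp => //; exact: measurable_sheared.
  - apply: emeasurable_funM => //; apply/measurable_EFinP; exact: measurableT_comp.
  move=> y _; rewrite EFinM muleAC -EFinM.
  apply: (@le_trans _ _ (\int[mu]_t ((M * `|F y|)%:E * (k t)%:E))%E).
    apply: ge0_le_integral => //.
    - apply: measurableT_comp => //.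
      apply: (measurableT_comp (measurable_sheared mF mg)); exact: pair1_measurable.
    - by apply: emeasurable_funM => //; apply/measurable_EFinP.
    move=> t _; rewrite /sheared/= -EFinM lee_fin !normrM (ger0_norm (k0 t)).
    rewrite mulrCA mulrC (mulrC `|F y|) ler_wpM2r// ler_wpM2r//.
  rewrite ge0_integralZl//; last first.
  - by rewrite lee_fin mulr_ge0.
  - by move=> t _; rewrite lee_fin.
  - exact/measurable_EFinP.
  by rewrite -[X in (_ * X <= _)%E]fineK// EFinM -!EFinM lee_fin mulrAC.
rewrite ge0_integralZl//; last first.
- by rewrite lee_fin mulr_ge0// fine_ge0// integral_ge0// => t _; rewrite lee_fin.
- by apply/measurable_EFinP; exact: measurableT_comp.
rewrite lte_mul_pinfty//.
- by rewrite lee_fin mulr_ge0// fine_ge0// integral_ge0// => t _; rewrite lee_fin.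
- by case/integrableP : iF.
Qed.

Let shift_sheared (F g : plane -> R) x t : shifted F g (x + s t, t) = sheared F g (x, t).
Proof. by rewrite /shifted /sheared/= addrK; congr (_%:E); ring. Qed.

(** When the plane is integrated first, the shift identifies the inner integrals with those of
    [sheared], whose integrability is known. *)
Let integrable_shifted (F g : plane -> R) : nu.-integrable setT (EFin \o F) -> bm g ->
  (snu \x mu)%E.-integrable setT (shifted F g).
Proof.
move=> iF bg; have [mg _] := bg.
have mF : measurable_fun setT F by apply/measurable_EFinP; exact: measurable_int iF.
apply: ((@integrable21ltyP _ _ plane line R snu mu _ (measurable_shifted mF mg)).2).
have H := (@integrable21ltyP _ _ plane line R snu mu _ (measurable_sheared mF mg)).1 (integrable_sheared iF bg).
apply: (le_lt_trans _ H); rewrite le_eqVlt; apply/orP; left; apply/eqP; apply/esym; apply: eq_integral => t _.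
rewrite -[RHS](ge0_integral_shift (s t))//.
  by apply: eq_integral => x _; rewrite shift_sheared.
apply: measurableT_comp => //.
apply: (measurableT_comp (measurable_shifted mF mg)); exact: pair2_measurable.
Qed.

Let shifted_integral (F g : plane -> R) x :
  mu.-integrable setT (EFin \o (fun t => k t * F (x - s t))) ->
  (\int[mu]_t shifted F g (x, t) = (g x * curve_average k (fun t => - s t) F x)%:E)%E.
Proof.
move=> i; rewrite EFinM /curve_average /Rintegral fineK; last exact: integrable_fin_num.
by rewrite -integralZl.
Qed.

(** Fubini on both sides, with a translation at each fixed [t] in between. [F] is allowed to be
    unbounded because it will be [b] times a bounded function. *)
Lemma curve_average_duality (F g : R * R -> R) :
  nu.-integrable setT (EFin \o (F : plane -> R)) -> bm g ->
  nu.-integrable setT (EFin \o (fun x : plane => g x * curve_average k (fun t => - s t) F x)) /\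
  \int[nu]_x (g x * curve_average k (fun t => - s t) F x) =
  \int[nu]_y (F y * curve_average k s g y).
Proof.
move=> iF bg; have [mg _] := bg.
have mF : measurable_fun [set: plane] (F : plane -> R).
  by apply/measurable_EFinP; exact: measurable_int iF.
(* For unbounded [F] the integral along the curve through [x] converges only for almost every [x]:
   Fubini with [1] in place of [g]. The remaining null set does not affect the integrals. *)
have ae : {ae nu, forall x : plane, setT x -> (\int[mu]_t shifted F g (x, t) = (g x * curve_average k (fun t => - s t) F x)%:E)%E}.
  have := @ae_integrable1 _ _ plane line R snu mu _ (integrable_shifted iF (bm_cst plane 1)).
  apply: filterS => x H _; apply: shifted_integral.
  by apply: eq_integrable H => //= t _; rewrite /shifted/= mul1r.
have mA : measurable_fun [set: plane] (EFin \o (fun x : plane => g x * curve_average k (fun t => - s t) F x)).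
  by apply/measurable_EFinP; apply: measurable_funM => //; exact: measurable_curve_average.
have iF1 := @integrable_fubini_F _ _ plane line R snu mu _ (integrable_shifted iF bg).
have mF1 := measurable_int _ iF1.
split.
  apply/integrableP; split => //.
  case/integrableP : iF1 => _ H; apply: (le_lt_trans _ H); rewrite le_eqVlt; apply/orP; left; apply/eqP; apply/esym.
  apply: ge0_ae_eq_integral => //; [exact: measurableT_comp|exact: measurableT_comp|].
  by apply: filterS ae => x + _; rewrite /fubini_F => ->.
rewrite /Rintegral; congr fine.
transitivity (\int[nu]_x \int[mu]_t shifted F g (x, t))%E.
  by apply/esym; apply: ae_eq_integral.
rewrite (@Fubini _ _ plane line R snu mu _ (integrable_shifted iF bg)).
transitivity (\int[nu]_y \int[mu]_t sheared F g (y, t))%E; last first.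
  apply: eq_integral => y _; rewrite EFinM /curve_average /Rintegral fineK.
    by rewrite -integralZl//; exact: curve_integrand_integrable.
  by apply: integrable_fin_num => //; exact: curve_integrand_integrable.
rewrite (@Fubini _ _ plane line R snu mu _ (integrable_sheared iF bg)).
apply: eq_integral => t _.
have i1 : nu.-integrable setT (fun x : plane => shifted F g (x, t)).
  apply: (@integrable_bmM _ plane R nu g (fun x => k t * F (x - s t))) => //.
  apply: (@integrable_bmM _ plane R nu (fun=> k t)); first exact: bm_cst.
  exact: (integral_shift (- s t) iF).1.
rewrite -(integral_shift (s t) i1).2.
by apply: eq_integral => x _; rewrite shift_sheared.
Qed.

End Duality.

(** * The abstract contraction argument *)

Section Contraction.
Context d (X : measurableType d) (R : realType) (m : {measure set X -> \bar R}).
Local Notation bm := (@bounded_measurable d X R).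
Implicit Types f g phi : X -> R.

Lemma integrable_indic_fin (A : set X) : measurable A -> (m A < +oo)%E ->
  m.-integrable setT (EFin \o \1_A).
Proof.
move=> mA Afin; apply/integrableP; split; first exact/measurable_EFinP/measurable_indic.
under eq_integral do rewrite /= ger0_norm//.
by rewrite integral_indic// setIT.
Qed.

(** Linearity is required only on bounded measurable functions, where curve averages are finite; one
    identity encodes additivity and homogeneity. *)
Definition positive_operator (A : (X -> R) -> X -> R) :=
  [/\ forall f, bm f -> bm (A f),
      forall c f g x, bm f -> bm g -> A (fun y => c * f y + g y) x = c * A f x + A g x
    & forall f x, (forall y, 0 <= f y) -> 0 <= A f x].

Section Positive_operator.
Context (A : (X -> R) -> X -> R) (pA : positive_operator A).

Lemma posop_bm f : bm f -> bm (A f).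
Proof. by case: pA => + _ _; apply. Qed.

Lemma posop_ge0 f x : (forall y, 0 <= f y) -> 0 <= A f x.
Proof. by case: pA => _ _; apply. Qed.

Lemma posopB f g x : bm f -> bm g -> A (fun y => f y - g y) x = A f x - A g x.
Proof.
case: pA => _ + _ bf bg => /(_ (- 1) g f x bg bf); rewrite mulN1r addrC => <-.
by congr (A _ x); apply/funext => y; rewrite mulN1r addrC.
Qed.

Lemma posop0 x : A (fun=> 0) x = 0.
Proof.
have H := @posopB (fun=> 0) (fun=> 0) x (bm_cst X 0) (bm_cst X 0).
rewrite -[RHS](subrr (A (fun=> 0) x)) -H.
by by congr (A _ x); apply/funext => y; rewrite subr0.
Qed.

Lemma posopZ c f x : bm f -> A (fun y => c * f y) x = c * A f x.
Proof.
case: pA => _ + _ bf => /(_ c f (fun=> 0) x bf (bm_cst X 0)).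
rewrite posop0 addr0 => <-; congr (A _ x); apply/funext => y; by rewrite addr0.
Qed.

Lemma ler_posop f g x : bm f -> bm g -> (forall y, f y <= g y) -> A f x <= A g x.
Proof.
move=> bf bg fg; rewrite -subr_ge0 -posopB//.
by apply: posop_ge0 => y; rewrite subr_ge0.
Qed.

Lemma normr_posop f g x : bm f -> bm g -> (forall y, `|f y| <= g y) -> `|A f x| <= A g x.
Proof.
move=> bf bg fg; rewrite ler_norml; apply/andP; split; last first.
  by apply: ler_posop => // y; apply: le_trans (fg y); exact: ler_norm.
rewrite -mulN1r -posopZ//; apply: ler_posop => //.
  by apply: bmM => //; exact: bm_cst.
by move=> y; rewrite mulN1r; have := fg y; rewrite ler_norml => /andP[].
Qed.

End Positive_operator.

Context (A B : (X -> R) -> X -> R) (pA : positive_operator A) (pB : positive_operator B).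
Context (D E : set X) (mD : measurable D) (mE : measurable E).
Hypothesis Dfin : (m D < +oo)%E.
Context (b : X -> R) (N c kappa V0 W0 : R) (S : X -> set X).
Hypothesis mS : forall y, measurable (S y).
Hypothesis ib : m.-integrable setT (EFin \o b).
Hypothesis dual : forall f g, measurable_fun setT f -> measurable_fun setT g ->
  (forall x, `|f x| <= \1_D x) -> (forall x, `|g x| <= \1_E x) ->
  \int[m]_x (g x * A f x) = \int[m]_x (f x * B g x).
Hypothesis pairing : forall f g, measurable_fun setT f -> measurable_fun setT g ->
  (forall x, `|f x| <= \1_D x) -> (forall x, `|g x| <= \1_E x) ->
  `| \int[m]_x (b x * (g x * A f x - f x * B g x)) | <= N.
Hypothesis V0P : forall x, A \1_D x <= V0.
Hypothesis W0P : forall x, B \1_E x <= W0.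
Hypothesis V0gt0 : 0 < V0.
Hypothesis W0gt0 : 0 < W0.
Hypothesis c0 : 0 <= c.
(* [S y] is the exceptional strip around [y] which the two-step kernel may miss. *)
Hypothesis minorization : forall f y, bm f -> (forall x, 0 <= f x) -> (forall x, ~ D x -> f x = 0) -> D y ->
  c * \int[m]_x (f x * \1_(~` S y) x) <= B (fun x => \1_E x * A f x) y.

(** The total mass that a point of [D] sends to [E]. The ball [|phi| <= w] consists of the densities
    [f * B \1_E] with [|f| <= \1_D], and [P] below preserves it. *)
Definition balanced_weight x := \1_D x * B \1_E x.
Local Notation w := balanced_weight.

Hypothesis smallS : forall y, D y -> \int[m]_x (w x * \1_(S y) x) <= (\int[m]_x w x) / 4.
Hypothesis kappa01 : 0 < kappa < 1.
(** On the right is the guaranteed gap between [P w] and [P phi]: the two denominators of [P] cost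
    [(W0 * V0)^-1], the minorization gives [c], and half the mass of [w] lies outside the strip. On
    the left is an upper bound for [kappa * w]. *)
Hypothesis kappaP : kappa * W0 <= (W0 * V0)^-1 * (c * (\int[m]_x w x / 2)).

(* The Markov operator: [D] to [E] by [A], back to [D] by [B]. *)
Let P phi x := \1_D x * B (fun z => \1_E z * A (fun y => phi y / B \1_E y) z / A \1_D z) x.

Let ind01 (U : set X) x : 0 <= (\1_U x : R) <= 1.
Proof. by rewrite indicE; case: (_ \in _) => /=; rewrite lexx ler01. Qed.

Let W_ge0 x : 0 <= B \1_E x.
Proof. by apply: posop_ge0 => // y; case/andP: (ind01 E y). Qed.

Let V_ge0 x : 0 <= A \1_D x.
Proof. by apply: posop_ge0 => // y; case/andP: (ind01 D y). Qed.

Let bW : bm (B \1_E).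
Proof. by apply: posop_bm => //; exact: bm_indic. Qed.

Let bV : bm (A \1_D).
Proof. by apply: posop_bm => //; exact: bm_indic. Qed.

Let w_ge0 x : 0 <= w x.
Proof. by rewrite mulr_ge0//; case/andP: (ind01 D x). Qed.

Let bw : bm w.
Proof. by apply: bmM => //; exact: bm_indic. Qed.

Let mdiv f g : measurable_fun setT f -> measurable_fun setT g -> (forall x, 0 <= g x) ->
  measurable_fun setT (fun x => f x / g x).
Proof. by move=> mf mg g0; apply: measurable_funM => //; exact: measurable_funV. Qed.

Let bm_dom f (U : set X) : measurable U -> measurable_fun setT f -> (forall x, `|f x| <= \1_U x) -> bm f.
Proof. by move=> mU mf; apply: bm_dominated => //; exact: bm_indic. Qed.

(* [v] may vanish: then so does [f], and the quotient is the junk value 0. *)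
Let divl (f : X -> R) (U : set X) (v : X -> R) : (forall x, 0 <= v x) ->
  (forall x, `|f x| <= \1_U x * v x) ->
  (forall x, `|f x / v x| <= \1_U x) /\ (forall x, f x / v x * v x = f x).
Proof.
move=> v0 fv; split=> x.
  have [vx0|vx0] := eqVneq (v x) 0.
    by rewrite vx0 invr0 mulr0 normr0; case/andP: (ind01 U x).
  have vxp : 0 < v x by rewrite lt_neqAle eq_sym vx0 v0.
  by rewrite normrM normfV (gtr0_norm vxp) ler_pdivrMr.
have [vx0|vx0] := eqVneq (v x) 0; last by rewrite mulfVK.
have := fv x; rewrite vx0 !mulr0 => H; apply/esym/eqP.
by rewrite -normr_le0.
Qed.

(** Turns a density of the ball into a function to which [dual] and [pairing] apply, together with
    [\1_E]. *)
Let step1 phi : measurable_fun setT phi -> (forall x, `|phi x| <= w x) ->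
  let f := fun y => phi y / B \1_E y in
  [/\ measurable_fun setT f, forall x, `|f x| <= \1_D x & forall x, f x * B \1_E x = phi x].
Proof.
move=> mphi phiw; have [h1 h2] := divl W_ge0 phiw; split=> //.
by apply: mdiv => //; case: bW.
Qed.

(** The same factorization on the side of [E]: the transported density [\1_E * A f] becomes
    [g * A \1_D], so that [dual] and [pairing] apply to [\1_D] and [g]. *)
Let step2 f : measurable_fun setT f -> (forall x, `|f x| <= \1_D x) ->
  let g := fun z => \1_E z * A f z / A \1_D z in
  [/\ measurable_fun setT g, forall x, `|g x| <= \1_E x & forall x, g x * A \1_D x = \1_E x * A f x].
Proof.
move=> mf fD; have bf : bm f by exact: (bm_dom mD).
have [|h1 h2] := @divl (fun x => \1_E x * A f x) E _ V_ge0.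
  move=> x; rewrite normrM ger0_norm; last by case/andP: (ind01 E x).
  by rewrite ler_wpM2l//; apply: normr_posop => //; exact: bm_indic.
split=> //; apply: mdiv => //; last by case: bV.
by apply: measurable_funM; [exact: measurable_indic|case: (posop_bm pA bf)].
Qed.

Let integrableD f : bm f -> (forall x, ~ D x -> f x = 0) -> m.-integrable setT (EFin \o f).
Proof.
move=> bf fD.
have -> : f = (fun x => f x * \1_D x).
  apply/funext => x; rewrite indicE; case: (boolP (x \in D)); rewrite ?mulr1//.
  by rewrite notin_setE => /fD ->; rewrite mul0r.
by apply: integrable_bmM => //; exact: integrable_indic_fin.
Qed.

(** The mass passes from [phi = f * B \1_E] to [\1_E * A f = g * A \1_D] and on to
    [\1_D * B g = P phi], by [dual] twice. With the factor [b] in the integral, each passage costs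
    at most [N] by [pairing]. *)
Let P_facts phi : measurable_fun setT phi -> (forall x, `|phi x| <= w x) ->
  [/\ measurable_fun setT (P phi), forall x, `|P phi x| <= w x,
     \int[m]_x P phi x = \int[m]_x phi x &
     \int[m]_x (b x * phi x) <= \int[m]_x (b x * P phi x) + N *+ 2].
Proof.
move=> mphi phiw; have bphi : bm phi := bm_dominated mphi bw phiw.
have [mf fD fW] := step1 mphi phiw.
set f := fun y => _ in mf fD fW.
have bf : bm f := bm_dom mD mf fD.
have [mg gE gV] := step2 mf fD.
set g := fun z => _ in mg gE gV.
have bg : bm g := bm_dom mE mg gE.
have PE : P phi = fun x => \1_D x * B g x by [].
have bP : bm (P phi).
  by rewrite PE; apply: bmM; [exact: bm_indic|exact: posop_bm].
have b1 : bm (fun x => \1_E x * A f x).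
  by apply: bmM; [exact: bm_indic|exact: posop_bm].
have m1D : measurable_fun setT (\1_D : X -> R) by exact: measurable_indic.
have m1E : measurable_fun setT (\1_E : X -> R) by exact: measurable_indic.
have D1 x : `|\1_D x : R| <= \1_D x by rewrite ger0_norm.
have E1 x : `|\1_E x : R| <= \1_E x by rewrite ger0_norm.
split.
- by case: bP.
- move=> x; rewrite PE normrM ger0_norm// ler_wpM2l//.
  by apply: normr_posop => //; exact: bm_indic.
- rewrite PE -(dual m1D mg D1 gE).
  under eq_Rintegral do rewrite gV.
  rewrite (dual mf m1E fD E1).
  by under eq_Rintegral do rewrite fW.
- have p1 := pairing mf m1E fD E1.
  have p2 := pairing m1D mg D1 gE.
  move: p1 p2.
  rewrite (_ : \int[m]_x (b x * (\1_E x * A f x - f x * B \1_E x)) =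
      \int[m]_x (b x * (\1_E x * A f x)) - \int[m]_x (b x * phi x)); last first.
    rewrite -RintegralB//; [|exact: integrable_Mbm|exact: integrable_Mbm].
    by apply: eq_Rintegral => x _; rewrite fW mulrBr.
  rewrite (_ : \int[m]_x (b x * (g x * A \1_D x - \1_D x * B g x)) =
      \int[m]_x (b x * (\1_E x * A f x)) - \int[m]_x (b x * P phi x)); last first.
    rewrite -RintegralB//; [|exact: integrable_Mbm|exact: integrable_Mbm].
    by apply: eq_Rintegral => x _; rewrite gV PE mulrBr.
  rewrite !ler_norml mulr2n => /andP[h1 _] /andP[_ h2]; lra.
Qed.

Let mw : measurable_fun setT w. Proof. by case: bw. Qed.

Let ww x : `|w x| <= w x. Proof. by rewrite ger0_norm. Qed.

Let outside f : (forall x, `|f x| <= w x) -> forall x, ~ D x -> f x = 0.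
Proof.
move=> fw x nDx; have := fw x; rewrite /w indicE memNset// mul0r normr_le0.
by move/eqP.
Qed.

Let integrable_w f : measurable_fun setT f -> (forall x, `|f x| <= w x) ->
  m.-integrable setT (EFin \o f).
Proof.
move=> mf fw; apply: integrableD; last exact: outside.
exact: bm_dominated mf bw fw.
Qed.

(** Since [w - phi] is nonnegative, replacing the denominators [B \1_E] and [A \1_D] by their upper
    bounds [W0] and [V0] only decreases [P w - P phi]. *)
Let kernel_lower_bound phi y : measurable_fun setT phi -> (forall x, `|phi x| <= w x) -> D y ->
  (W0 * V0)^-1 * B (fun x => \1_E x * A (fun z => w z - phi z) x) y <= P w y - P phi y.
Proof.
move=> mphi phiw Dy; have bphi : bm phi := bm_dominated mphi bw phiw.
have [mf fD fW] := step1 mphi phiw.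
set f := fun y => _ in mf fD fW.
have bf : bm f := bm_dom mD mf fD.
have [mg gE gV] := step2 mf fD.
set g := fun z => _ in mg gE gV.
have bg : bm g := bm_dom mE mg gE.
have [mfw fwD fwW] := step1 mw ww.
set fw := fun y => _ in mfw fwD fwW.
have bfw : bm fw := bm_dom mD mfw fwD.
have [mgw gwE gwV] := step2 mfw fwD.
set gw := fun z => _ in mgw gwE gwV.
have bgw : bm gw := bm_dom mE mgw gwE.
set psi := fun z => w z - phi z.
have bpsi : bm psi by exact: bmB.
have psi0 x : 0 <= psi x.
  by rewrite subr_ge0; apply: le_trans (phiw x); exact: ler_norm.
have fwf z : W0^-1 * psi z <= fw z - f z.
  rewrite /fw /f -mulrBl -/(psi z) mulrC.
  have [Wz|Wz] := eqVneq (B \1_E z) 0.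
    suff -> : psi z = 0 by rewrite !mul0r.
    have := phiw z; rewrite /psi /w Wz mulr0 normr_le0 => /eqP ->.
    by rewrite subr0.
  have Wp : 0 < B \1_E z by rewrite lt_neqAle eq_sym Wz W_ge0.
  by rewrite ler_wpM2l// lef_pV2 ?posrE.
have b1 : bm (fun x => \1_E x * A psi x).
  by apply: bmM; [exact: bm_indic|exact: posop_bm].
have Pw : P w y = B gw y by rewrite /P indicE mem_set// mul1r.
have Pf : P phi y = B g y by rewrite /P indicE mem_set// mul1r.
rewrite Pw Pf -posopB// -posopZ//; apply: ler_posop => //.
- by apply: bmM => //; exact: bm_cst.
- exact: bmB.
move=> z; rewrite /gw /g -mulrBl -mulrBr -posopB//.
have Apsi0 : 0 <= A psi z by exact: posop_ge0.
(* Where the denominator vanishes, so does the numerator, because [0 <= psi <= 2 W0 \1_D]; the junk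
   quotient is then harmless. *)
have [Vz|Vz] := eqVneq (A \1_D z) 0.
  rewrite Vz invr0 mulr0; suff -> : A psi z = 0 by rewrite !mulr0.
  apply/eqP; rewrite eq_le Apsi0 andbT.
  apply: (@le_trans _ _ (A (fun x => (W0 *+ 2) * \1_D x) z)); last first.
    by rewrite posopZ ?Vz ?mulr0//; exact: bm_indic.
  apply: ler_posop => //.
    by apply: bmM; [exact: bm_cst|exact: bm_indic].
  move=> x; apply: (@le_trans _ _ (w x *+ 2)).
    rewrite mulr2n /psi lerD2l; have := phiw x; rewrite ler_norml => /andP[h _].
    by rewrite lerNl.
  have h : \1_D x * B \1_E x <= \1_D x * W0 by rewrite ler_wpM2l.
  by rewrite [w x]/balanced_weight !mulr2n; lra.
have Vp : 0 < A \1_D z by rewrite lt_neqAle eq_sym Vz V_ge0.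
rewrite mulrCA -mulrA; apply: ler_wpM2l => //.
rewrite invfM [X in X * _]mulrC -mulrA mulrC; apply: ler_pM => //.
- by rewrite mulr_ge0// invr_ge0 ltW.
- by rewrite invr_ge0 ltW.
- rewrite -posopZ//; apply: ler_posop => //; last exact: bmB.
  by apply: bmM => //; exact: bm_cst.
- by rewrite lef_pV2 ?posrE.
Qed.

(* [w - phi] has the same mass as [w], of which [S y] carries at most half since
   [w - phi <= 2 w]. *)
Let mass_outside_S phi y : measurable_fun setT phi -> (forall x, `|phi x| <= w x) ->
  \int[m]_x phi x = 0 -> D y ->
  \int[m]_x w x / 2 <= \int[m]_x ((w x - phi x) * \1_(~` S y) x).
Proof.
move=> mphi phiw phi0 Dy; have bphi : bm phi := bm_dominated mphi bw phiw.
have iw : m.-integrable setT (EFin \o w) by exact: integrable_w.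
have iphi : m.-integrable setT (EFin \o phi) by exact: integrable_w.
have bS : bm (\1_(S y)) by exact: bm_indic.
have iwS : m.-integrable setT (EFin \o (fun x => w x * \1_(S y) x)) by exact: integrable_Mbm.
have i2 : m.-integrable setT (EFin \o (fun x => 2 * (w x * \1_(S y) x))).
  by apply: integrable_bmM => //; exact: bm_cst.
have i3 : m.-integrable setT (EFin \o (fun x => w x - phi x)).
  by apply: integrableD; [exact: bmB|move=> x nD; rewrite (outside phiw)// (outside ww)// subr0].
have i4 : m.-integrable setT (EFin \o (fun x => (w x - phi x) * \1_(~` S y) x)).
  by apply: integrable_Mbm => //; apply: bm_indic; exact: measurableC.
have : \int[m]_x (w x - phi x - 2 * (w x * \1_(S y) x)) <=
    \int[m]_x ((w x - phi x) * \1_(~` S y) x).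
  apply: le_Rintegral => //.
    exact: (integrableB measurableT i3 i2).
  move=> x _; rewrite indicC indicE; have := phiw x; rewrite ler_norml => /andP[h1 h2].
  by case: (x \in S y); rewrite /= ?mulr1 ?mulr0; lra.
rewrite RintegralB// RintegralB// phi0 subr0 RintegralZl//.
by have := smallS Dy; lra.
Qed.

(** On [D], [P w <= w], and [P w - P phi] is at least [kappa * W0 >= kappa * w] by
    [kernel_lower_bound], [minorization] and [mass_outside_S]. Off [D] both sides vanish. *)
Let contract1 phi y : measurable_fun setT phi -> (forall x, `|phi x| <= w x) ->
  \int[m]_x phi x = 0 -> P phi y <= (1 - kappa) * w y.
Proof.
move=> mphi phiw phi0.
have [mP Pw _ _] := P_facts mphi phiw.
have [Dy|nDy] := pselect (D y); last first.
  by rewrite (outside Pw nDy) (outside ww nDy) mulr0.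
have [_ Pww _ _] := P_facts mw ww.
have h1 : P w y <= w y by apply: le_trans (Pww y); exact: ler_norm.
have h2 := kernel_lower_bound mphi phiw Dy.
have h3 := mass_outside_S mphi phiw phi0 Dy.
have bpsi : bm (fun x => w x - phi x).
  by apply: bmB => //; exact: bm_dominated mphi bw phiw.
have h4 : c * \int[m]_x ((w x - phi x) * \1_(~` S y) x) <=
    B (fun x => \1_E x * A (fun z => w z - phi z) x) y.
  apply: minorization => // x.
    by rewrite subr_ge0; apply: le_trans (phiw x); exact: ler_norm.
  by move=> nD; rewrite (outside phiw)// (outside ww)// subr0.
have wW0 : w y <= W0.
  by apply: (le_trans _ (W0P y)); rewrite ler_piMl//; case/andP: (ind01 D y).
have h5 : kappa * w y <= kappa * W0.
  by case/andP: kappa01 => k0 _; rewrite ler_wpM2l// ltW.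
have h6 : (W0 * V0)^-1 * (c * (\int[m]_x w x / 2)) <=
   (W0 * V0)^-1 * B (fun x => \1_E x * A (fun z => w z - phi z) x) y.
  apply: ler_wpM2l; first by rewrite invr_ge0 mulr_ge0// ltW.
  by apply: (le_trans _ h4); rewrite ler_wpM2l.
by rewrite mulrBl mul1r; have := kappaP; lra.
Qed.

Let PN phi : measurable_fun setT phi -> (forall x, `|phi x| <= w x) ->
  forall x, P (fun y => - phi y) x = - P phi x.
Proof.
move=> mphi phiw x; have bphi : bm phi := bm_dominated mphi bw phiw.
have [mf fD fW] := step1 mphi phiw.
have bf := bm_dom mD mf fD.
have [mg gE gV] := step2 mf fD.
have bg := bm_dom mE mg gE.
rewrite /P -mulrN; congr (_ * _); rewrite -mulN1r -posopZ//.
congr (B _ x); apply/funext => z.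
rewrite mulN1r -mulNr -mulrN; congr (_ * _ / _); rewrite -mulN1r -posopZ//.
by congr (A _ z); apply/funext => y; rewrite mulN1r mulNr.
Qed.

Theorem pairing_balanced phi : measurable_fun setT phi -> (forall x, `|phi x| <= w x) ->
  \int[m]_x phi x = 0 -> kappa * \int[m]_x (b x * phi x) <= N *+ 2.
Proof.
case/andP: kappa01 => k0 k1.
pose K := [set phi : X -> R | [/\ measurable_fun setT phi, forall x, `|phi x| <= w x & \int[m]_x phi x = 0]].
pose V := [set \int[m]_x (b x * phi x) | phi in K].
(* Integrability of [b] and boundedness of [w] make the supremum finite; otherwise it could not be
   absorbed. *)
have iabs : m.-integrable setT (EFin \o (fun x => `|b x| * w x)).
  by apply: integrable_Mbm => //; exact: integrable_norm.
have Vub : has_ubound V.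
  exists (\int[m]_x (`|b x| * w x)) => _ [f [mf fw _] <-].
  apply: le_Rintegral => //.
    by apply: integrable_Mbm => //; exact: bm_dominated mf bw fw.
  move=> x _; apply: (le_trans (ler_norm _)); rewrite normrM.
  by rewrite ler_wpM2l.
move=> mphi phiw phi0.
have Vphi : V (\int[m]_x (b x * phi x)) by exists phi.
have supV : has_sup V by split => //; exists (\int[m]_x (b x * phi x)).
(* Passing from [f] to [P f] costs at most [2 N], and [P f / (1 - kappa)] belongs to [K] again. *)
have step : sup V <= (1 - kappa) * sup V + N *+ 2.
  apply: ge_sup; first by case: supV.
  move=> _ [f [mf fw f0] <-].
  have [mP Pw PI Pb] := P_facts mf fw.
  apply: (le_trans Pb); rewrite lerD2r.
  have bP : bm (P f) := bm_dominated mP bw Pw.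
  rewrite mulrC -ler_pdivrMr ?subr_gt0//.
  have -> : \int[m]_x (b x * P f x) / (1 - kappa) = \int[m]_x (b x * ((1 - kappa)^-1 * P f x)).
    rewrite mulrC -RintegralZl//; last exact: integrable_Mbm.
    by apply: eq_Rintegral => x _; rewrite mulrCA.
  apply: sup_upper_bound => //; exists (fun x => (1 - kappa)^-1 * P f x) => //; split.
  - by apply: measurable_funM.
  - move=> x; have i0 : 0 <= (1 - kappa)^-1 by rewrite invr_ge0 subr_ge0 ltW.
    rewrite normrM (ger0_norm i0) mulrC ler_pdivrMr ?subr_gt0// [w x * _]mulrC.
    rewrite ler_norml contract1// andbT.
    (* [contract1] is one-sided; the lower bound is the upper bound for [- f]. *)
    rewrite lerNl -(PN mf fw); apply: contract1.
    + by apply: measurable_funN.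
    + by move=> z; rewrite normrN.
    + under eq_Rintegral do rewrite -mulN1r.
      by rewrite RintegralZl ?f0 ?mulr0//; exact: integrable_w.
  - rewrite RintegralZl//; last exact: integrable_w.
    by rewrite PI f0 mulr0.
apply: (@le_trans _ _ (kappa * sup V)).
  by rewrite ler_wpM2l//; [exact: ltW|exact: sup_upper_bound].
lra.
Qed.

End Contraction.

(** * The parabola and the two regions *)

Section Geometry.
Context (R : realType).
Local Notation mu := (@lebesgue_measure R).
Local Notation line := (measurableTypeR R).
Local Notation plane := (line * line)%type.
Local Notation nu := (@plane_measure R).
Local Notation bm := (@bounded_measurable _ plane R).

Lemma measurable_norm_ball d (T : measurableType d) (f : T -> R) (r : R) :
  measurable_fun setT f -> measurable [set x | `|f x| <= r].
Proof.
move=> mf; rewrite (_ : [set x | _] = setT `&` (fun x => `|f x| <= r) @^-1` [set true]).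
  by apply: measurable_fun_ler => //; exact: measurableT_comp.
by rewrite setTI; apply/seteqP; split.
Qed.

Lemma lebesgue_measure_bounded_itv (b1 b2 : bool) (p q : R) : p <= q ->
  mu [set` Interval (BSide b1 p) (BSide b2 q)] = (q - p)%:E.
Proof.
move=> pq; rewrite [LHS]lebesgue_measure_itv/= lte_fin; case: ifPn; first by rewrite -EFinB.
by rewrite -leNgt => qp; rewrite (_ : p = q) ?subrr//; apply/eqP; rewrite eq_le pq.
Qed.

Definition parallelogram (p q u v r : R) : set plane :=
  [set y | p <= y.1 <= q /\ `|y.2 - (u + v * y.1)| <= r].

Lemma measurable_parallelogram (p q u v r : R) : measurable (parallelogram p q u v r).
Proof.
rewrite (_ : parallelogram _ _ _ _ _ =
    ([set` `[p, q]] `*` setT) `&` [set y : plane | `|y.2 - (u + v * y.1)| <= r]).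
  apply: measurableI; first exact: measurableX.
  apply: measurable_norm_ball; apply: measurable_funB; first exact: measurable_snd.
  apply: measurable_funD => //; apply: measurable_funM => //; exact: measurable_fst.
apply/seteqP; split => -[y1 y2]; rewrite /parallelogram /= in_itv /=.
  by move=> [h1 h2]; split; [split|].
by move=> [[h1 _] h2]; split.
Qed.

(** Every vertical section over [[p, q]] is an interval of length [2 r], whatever the slope. *)
Lemma plane_measure_parallelogram (p q u v r : R) : p <= q -> 0 <= r ->
  nu (parallelogram p q u v r) = ((q - p) * (r *+ 2))%:E.
Proof.
move=> pq r0; rewrite /plane_measure/= /product_measure1/=.
transitivity (\int[mu]_x ((r *+ 2)%:E * (\1_(`[p, q] : set line) x)%:E))%E.
  apply: eq_integral => y1 _.
  rewrite indicE; case: (boolP (y1 \in _)) => h.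
    rewrite mule1.
    have -> : xsection (parallelogram p q u v r) y1 = [set` `[u + v * y1 - r, u + v * y1 + r]].
      apply/seteqP; split => t; rewrite /xsection/= inE /parallelogram/= in_itv/=.
        by case=> _; rewrite ler_norml => /andP[h1 h2]; apply/andP; split; lra.
      move=> /andP[h1 h2]; split; last by rewrite ler_norml; apply/andP; split; lra.
      by move: h; rewrite inE/= in_itv.
    rewrite [LHS]lebesgue_measure_bounded_itv; last by lra.
    by congr (_%:E); rewrite mulr2n; ring.
  rewrite mule0 (_ : xsection _ _ = set0) ?measure0//.
  apply/seteqP; split => t //; rewrite /xsection/= inE /parallelogram/= => -[h' _].
  by move/negP : h; apply; rewrite inE/= in_itv.
rewrite ge0_integralZl//.
- rewrite integral_indic// setIT [X in (_ * X)%E]lebesgue_measure_bounded_itv//.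
  by rewrite -EFinM mulrC.
- exact/measurable_EFinP/measurable_indic.
- by rewrite lee_fin mulrn_wge0.
Qed.

Lemma Rintegral_scaled_indic (p q c : R) : p <= q ->
  mu.-integrable setT (EFin \o (fun t : line => c * \1_(`[p, q] : set line) t)) /\
  \int[mu]_t (c * \1_(`[p, q] : set line) t) = c * (q - p).
Proof.
move=> pq.
have fin : mu `[p, q] = (q - p)%:E.
  exact: lebesgue_measure_bounded_itv.
have i : mu.-integrable setT (EFin \o (\1_(`[p, q] : set line) : line -> R)).
  by apply: integrable_indic_fin => //; rewrite [X in (X < _)%E]fin ltry.
split.
  by apply: integrable_bmM => //; exact: bm_cst.
by rewrite RintegralZl// /Rintegral integral_indic// setIT [X in fine X]fin.
Qed.


Context (c1 c2 lam : R).
Hypothesis lam0 : 0 < lam.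

(* The chord of the parabola near [t = 100 lam] has slope [200 lam], which is
   the slope of the long sides of [source]; [target] contains the translates of
   [source] by the points [parabola t] with [90 lam <= t + (y.1 - c1) <= 110 lam]. *)
Definition source : set plane :=
  parallelogram (c1 - lam) (c1 + lam) (c2 - 200 * lam * c1) (200 * lam) (lam ^+ 2).

Definition target : set plane :=
  parallelogram (c1 + 90 * lam) (c1 + 110 * lam) (c2 + (100 * lam) ^+ 2) 0 (3000 * lam ^+ 2).

(** The kernel [1 / t] restricted to an interval containing every time that joins a point of
    [source] to a point of [target]; [t] is positive there. *)
Definition kern (t : R) : R := (\1_(`[89 * lam, 111 * lam] : set R) t) / `|t|.

Definition strip (y : plane) : set plane := [set x | `|x.1 - y.1| < lam / 8].

Lemma measurable_strip y : measurable (strip y).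
Proof.
rewrite (_ : strip y = ~` [set x : plane | lam / 8 <= `|x.1 - y.1|]).
  apply: measurableC.
  rewrite (_ : [set x | _] = setT `&` (fun x : plane => lam / 8 <= `|x.1 - y.1|) @^-1` [set true]).
    apply: measurable_fun_ler => //; apply: measurableT_comp => //.
    by apply: measurable_funB => //; exact: measurable_fst.
  by rewrite setTI; apply/seteqP; split.
by apply/seteqP; split => x /=; rewrite /strip/= ltNge => /negP.
Qed.

Lemma translate_in_target y t : source y -> c1 + 90 * lam <= y.1 + t <= c1 + 110 * lam ->
  target (y + parabola t).
Proof.
case: y => y1 y2; rewrite /source /target /parallelogram/= => -[/andP[h1 h2]].
rewrite !ler_norml => /andP[h3 h4] /andP[h5 h6]; split; first by rewrite h5 h6.
set d := y1 - c1; set e := y2 - (c2 - 200 * lam * c1 + 200 * lam * y1) in h3 h4.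
set tau := t - 100 * lam.
(* The vertical offset from the centre line of [target], expanded about [t = 100 lam]. Its size is
   at most [(200 + 1 + 2200 + 121) lam ^+ 2], within the half-height [3000 lam ^+ 2]. *)
have -> : y2 + t ^+ 2 - (c2 + (100 * lam) ^+ 2 + 0 * (y1 + t)) =
  200 * (lam * d) + e + 200 * (lam * tau) + tau ^+ 2 by rewrite /d /e /tau; ring.
have d1 : - lam <= d by rewrite /d; lra.
have d2 : d <= lam by rewrite /d; lra.
have t1 : - (11 * lam) <= tau by rewrite /tau; lra.
have t2 : tau <= 11 * lam by rewrite /tau; lra.
have h l b : - (b * lam) <= l -> l <= b * lam -> - (b * lam ^+ 2) <= lam * l <= b * lam ^+ 2.
  by move=> l1 l2; apply/andP; split; nra.
have /andP[p1 p2] := h d 1 ltac:(by lra) ltac:(by lra).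
have /andP[p3 p4] := h tau 11 ltac:(by lra) ltac:(by lra).
have p5 : tau ^+ 2 <= 121 * lam ^+ 2 by nra.
have p6 : 0 <= tau ^+ 2 by exact: sqr_ge0.
by apply/andP; split; lra.
Qed.

Lemma source_target_time x t : target x -> source (x - parabola t) -> 89 * lam <= t <= 111 * lam.
Proof.
case: x => x1 x2; rewrite /source /target /parallelogram/= => -[/andP[h1 h2] _] [/andP[h3 h4] _].
by apply/andP; split; lra.
Qed.

(** The concave function [18 lam v - v ^+ 2 - 2 lam ^+ 2] of [v] is positive at [lam / 8] and at
    [2 lam], hence in between, which excludes [x > 9 lam]. *)
Lemma two_step_time_le v x : lam / 8 <= v -> v <= 2 * lam ->
  2 * v * x <= 2 * lam ^+ 2 + v ^+ 2 -> x <= 9 * lam.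
Proof.
move=> v1 v2 x1; rewrite leNgt; apply/negP => H.
have q1 : 0 <= (x - 9 * lam) * v by rewrite mulr_ge0// ?subr_ge0; [exact: ltW|clear -v1 v2; lra].
have q2 : 0 <= (v - lam / 8) * (2 * lam - v) by rewrite mulr_ge0// subr_ge0.
have q3 : 0 <= lam * (v - lam / 8) by rewrite mulr_ge0 ?subr_ge0// ltW.
have q4 : 0 < lam ^+ 2 by exact: exprn_gt0.
clear -x1 q1 q2 q3 q4; nra.
Qed.

(** The slope [200 lam] of [source] cancels the main part of the displacement. With [u = z.1 - y.1]
    and [tau = t - 100 lam], the offsets of [z] and [y] from the centre line differ by
    [2 u tau + u ^+ 2], which is therefore at most [2 lam ^+ 2] in size. *)
Lemma two_step_times y z t : source y -> source z -> lam / 8 <= `|z.1 - y.1| ->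
  z.2 = y.2 + (z.1 - y.1) ^+ 2 + 2 * (z.1 - y.1) * t ->
  91 * lam <= t <= 109 * lam /\ 91 * lam <= t + (z.1 - y.1) <= 109 * lam.
Proof.
case: y z => [y1 y2] [z1 z2]; rewrite /source /parallelogram/= => -[/andP[a1 a2]].
rewrite ler_norml => /andP[a3 a4] [/andP[b1 b2]]; rewrite ler_norml => /andP[b3 b4].
set u := z1 - y1; set tau := t - 100 * lam => u0 E.
have u1 : u <= 2 * lam by rewrite /u; lra.
have u2 : - (2 * lam) <= u by rewrite /u; lra.
have d1 : 2 * u * tau + u ^+ 2 <= 2 * lam ^+ 2 by rewrite /u /tau in E *; nra.
have d2 : - (2 * lam ^+ 2) <= 2 * u * tau + u ^+ 2 by rewrite /u /tau in E *; nra.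
(* Used for [w = tau] and [w = tau + u]: in both cases [2 u w] differs from [2 u tau + u ^+ 2] by
   [u ^+ 2]. *)
have key w : 2 * u * w <= 2 * lam ^+ 2 + u ^+ 2 ->
    - (2 * lam ^+ 2 + u ^+ 2) <= 2 * u * w -> - (9 * lam) <= w <= 9 * lam.
  clear -lam0 u0 u1 u2 => w1 w2; have [up|un] := lerP 0 u.
    rewrite ger0_norm// in u0; apply/andP; split; last exact: (two_step_time_le u0 u1).
    by rewrite lerNl; apply: (two_step_time_le u0 u1); clear -w2; lra.
  rewrite ltr0_norm// in u0; apply/andP; split; last first.
    by apply: (two_step_time_le u0); [rewrite lerNl|rewrite sqrrN; clear -w2; lra].
  by rewrite lerNl; apply: (two_step_time_le u0); [rewrite lerNl|rewrite sqrrN; clear -w1; lra].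
have u3 := sqr_ge0 u.
have k1 : - (9 * lam) <= tau <= 9 * lam by apply: key; clear -d1 d2 u3; lra.
have k2 : - (9 * lam) <= tau + u <= 9 * lam.
  by apply: key; clear -d1 d2 u3; nra.
move: k1 k2; rewrite /tau; clearbody u; clear => /andP[? ?] /andP[? ?].
by split; apply/andP; split; lra.
Qed.

Let mD : measurable source. Proof. exact: measurable_parallelogram. Qed.
Let mE : measurable target. Proof. exact: measurable_parallelogram. Qed.

Lemma source_measure : nu source = (4 * lam ^+ 3)%:E.
Proof.
have lam_gt0 := lam0.
have h : c1 - lam <= c1 + lam by lra.
rewrite (plane_measure_parallelogram _ _ h (sqr_ge0 lam)).
by congr (_%:E); rewrite mulr2n; ring.
Qed.

Lemma target_measure : nu target = (120 * 1000 * lam ^+ 3)%:E.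
Proof.
have lam_gt0 := lam0.
have h : c1 + 90 * lam <= c1 + 110 * lam by lra.
have h' : 0 <= 3000 * lam ^+ 2 by apply: mulr_ge0; [exact: ler0n|exact: sqr_ge0].
rewrite (plane_measure_parallelogram _ _ h h').
by congr (_%:E); rewrite mulr2n; ring.
Qed.

Lemma kern_ge0 t : 0 <= kern t.
Proof. by rewrite /kern indicE mulr_ge0// invr_ge0. Qed.

Lemma kern_le t : kern t <= (89 * lam)^-1.
Proof.
have lam_gt0 := lam0.
have ? : 0 < 89 * lam by lra.
rewrite /kern indicE; case: (boolP (t \in _)) => [|_].
  rewrite inE/= in_itv/= => /andP[h _]; rewrite mul1r.
  have tp : 0 < t by lra.
  by rewrite gtr0_norm// lef_pV2 ?posrE.
by rewrite mul0r invr_ge0 ltW.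
Qed.

Lemma kern_ge t : 89 * lam <= t <= 111 * lam -> (111 * lam)^-1 <= kern t.
Proof.
have lam_gt0 := lam0.
move=> tI; rewrite /kern indicE mem_set/= ?in_itv// mul1r.
move: tI => /andP[h1 h2]; have tp : 0 < t by lra.
by rewrite gtr0_norm// lef_pV2 ?posrE//; lra.
Qed.

Lemma kern_indic t : kern t <= (89 * lam)^-1 * \1_(`[89 * lam, 111 * lam] : set R) t.
Proof.
have := kern_le t; rewrite /kern indicE; case: (t \in _); rewrite ?mulr1 ?mul1r//.
by rewrite mul0r mulr0.
Qed.

Lemma integrable_kern : mu.-integrable setT (EFin \o (kern : line -> R)).
Proof.
have lam_gt0 := lam0.
have [i _] := @Rintegral_scaled_indic (89 * lam) (111 * lam) (89 * lam)^-1 ltac:(by move: lam0; lra).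
apply: (le_integrable measurableT _ _ i) => /=.
- apply/measurable_EFinP; apply: measurable_funM.
    by apply: measurable_indic; exact: measurable_itv.
  apply: measurable_funV => //; exact: measurableT_comp.
- move=> t _; rewrite lee_fin ger0_norm ?kern_ge0// (le_trans (kern_indic t))//.
  exact: ler_norm.
Qed.

Lemma measurable_parabola : measurable_fun [set: line] (@parabola R : line -> plane).
Proof. by apply/measurable_fun_pairP; split; rewrite /comp/=. Qed.

Lemma measurable_parabolaN : measurable_fun [set: line] ((fun t => - parabola t) : line -> plane).
Proof.
apply/measurable_fun_pairP; split; rewrite /comp/=.
  exact: measurableT_comp.
by apply: measurableT_comp => //.
Qed.

(** [forward] replaces the parabolic Hilbert transform for functions on [source] evaluated on
    [target]; [backward] is its adjoint. *)
Definition forward := curve_average kern (fun t => - parabola t).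
Definition backward := curve_average kern (@parabola R).

Lemma positive_curve_average s : measurable_fun [set: line] (s : line -> plane) ->
  @positive_operator _ plane R (curve_average kern s).
Proof.
move=> ms; split.
- by move=> f bf; apply: bm_curve_average => //; [exact: integrable_kern|exact: kern_ge0].
- move=> c f g x bf bg; rewrite curve_averageD//; last 2 first.
  + exact: integrable_kern.
  + by apply: bmM => //; exact: bm_cst.
  rewrite curve_averageZ//; exact: integrable_kern.
- by move=> f x f0; apply: curve_average_ge0 => //; exact: kern_ge0.
Qed.

(** The horizontal coordinate confines [t] to an interval of length [2 lam], and the kernel is at
    most [(89 lam)^-1]. *)
Lemma forward_source_le x : forward \1_source x <= 2 / 89.
Proof.
have lam_gt0 := lam0.
have [i e] := @Rintegral_scaled_indic (x.1 - c1 - lam) (x.1 - c1 + lam) (89 * lam)^-1 ltac:(by move: lam0; lra).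
apply: (@le_trans _ _ (\int[mu]_t ((89 * lam)^-1 * \1_(`[(x.1 - c1 - lam), (x.1 - c1 + lam)] : set line) t))).
  apply: le_Rintegral => //.
    apply: curve_integrand_integrable; [exact: integrable_kern|exact: measurable_parabolaN|exact: bm_indic].
  move=> t _; apply: ler_pM => //; [exact: kern_ge0|exact: kern_le|].
  rewrite !indicE; case: (boolP (_ \in source)) => // /set_mem [/andP[/= h1 h2] _].
  by rewrite mem_set//= in_itv/=; apply/andP; split; lra.
rewrite e; have l0 : lam != 0 by rewrite gt_eqF.
by rewrite le_eqVlt; apply/orP; left; apply/eqP; field.
Qed.

Lemma backward_target_le y : backward \1_target y <= 20 / 89.
Proof.
have lam_gt0 := lam0.
have [i e] := @Rintegral_scaled_indic (c1 + 90 * lam - y.1) (c1 + 110 * lam - y.1) (89 * lam)^-1 ltac:(by move: lam0; lra).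
apply: (@le_trans _ _ (\int[mu]_t ((89 * lam)^-1 * \1_(`[(c1 + 90 * lam - y.1), (c1 + 110 * lam - y.1)] : set line) t))).
  apply: le_Rintegral => //.
    apply: curve_integrand_integrable; [exact: integrable_kern|exact: measurable_parabola|exact: bm_indic].
  move=> t _; apply: ler_pM => //; [exact: kern_ge0|exact: kern_le|].
  rewrite !indicE; case: (boolP (_ \in target)) => // /set_mem [/andP[/= h1 h2] _].
  by rewrite mem_set//= in_itv/=; apply/andP; split; lra.
rewrite e; have l0 : lam != 0 by rewrite gt_eqF.
by rewrite le_eqVlt; apply/orP; left; apply/eqP; field.
Qed.

(** A whole interval of times of length [20 lam] leads from [y] into [target], and there the kernel
    is at least [(111 lam)^-1]. *)
Lemma backward_target_ge y : source y -> 20 / 111 <= backward \1_target y.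
Proof.
have lam_gt0 := lam0.
move=> Dy.
have [i e] := @Rintegral_scaled_indic (c1 + 90 * lam - y.1) (c1 + 110 * lam - y.1) (111 * lam)^-1 ltac:(by move: lam0; lra).
apply: (@le_trans _ _ (\int[mu]_t ((111 * lam)^-1 * \1_(`[(c1 + 90 * lam - y.1), (c1 + 110 * lam - y.1)] : set line) t))).
  rewrite e; have l0 : lam != 0 by rewrite gt_eqF.
  by rewrite le_eqVlt; apply/orP; left; apply/eqP; field.
apply: le_Rintegral => //.
  apply: curve_integrand_integrable; [exact: integrable_kern|exact: measurable_parabola|exact: bm_indic].
move=> t _; rewrite [X in _ * X <= _]indicE; case: (boolP (t \in _)) => [|_].
  rewrite inE/= in_itv/= => /andP[h1 h2]; rewrite mulr1.
  have [/andP[d1 d2] _] := Dy.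
  have -> : \1_target (y + parabola t) = 1 :> R.
    rewrite indicE mem_set//; apply: translate_in_target => //.
    by apply/andP; split; lra.
  by rewrite mulr1 kern_ge//; apply/andP; split; lra.
by rewrite mulr0 mulr_ge0// kern_ge0.
Qed.

End Geometry.

(** * The two-step kernel and the exceptional strip *)

Section Minorization.
Context (R : realType).
Local Notation mu := (@lebesgue_measure R).
Local Notation line := (measurableTypeR R).
Local Notation plane := (line * line)%type.
Local Notation nu := (@plane_measure R).
Local Notation bm := (@bounded_measurable _ plane R).
Context (c1 c2 lam : R).
Hypothesis lam0 : 0 < lam.
Local Notation D := (source c1 c2 lam).
Local Notation E := (target c1 c2 lam).
Local Notation k := (kern lam).
Local Notation A := (forward lam).
Local Notation B := (backward lam).

Let mD : measurable D. Proof. exact: measurable_parallelogram. Qed.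
Let mE : measurable E. Proof. exact: measurable_parallelogram. Qed.

Definition weight := @balanced_weight _ plane R B D E.

Lemma bm_backward f : bm f -> bm (B f).
Proof. by case: (positive_curve_average lam0 (@measurable_parabola R)) => + _ _; apply. Qed.

Lemma bm_forward f : bm f -> bm (A f).
Proof. by case: (positive_curve_average lam0 (@measurable_parabolaN R)) => + _ _; apply. Qed.

Lemma Rintegral_indic_plane (U : set plane) (r : R) : measurable U -> nu U = r%:E ->
  nu.-integrable setT (EFin \o (\1_U : plane -> R)) /\ \int[nu]_x \1_U x = r.
Proof.
move=> mU Ur; split; first by apply: integrable_indic_fin => //; rewrite [X in (X < _)%E]Ur ltry.
by rewrite /Rintegral integral_indic// setIT [X in fine X]Ur.
Qed.

Lemma integrable_weight : nu.-integrable setT (EFin \o (weight : plane -> R)).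
Proof.
have [i _] := Rintegral_indic_plane mD (source_measure c1 c2 lam0).
by apply: integrable_Mbm => //; apply: bm_backward; exact: bm_indic.
Qed.

Lemma weight_integral_ge : 80 / 111 * lam ^+ 3 <= \int[nu]_x weight x.
Proof.
have [i e] := Rintegral_indic_plane mD (source_measure c1 c2 lam0).
apply: (@le_trans _ _ (\int[nu]_x (20 / 111 * \1_D x))).
  by rewrite RintegralZl// e le_eqVlt; apply/orP; left; apply/eqP; field.
apply: le_Rintegral => //.
- by apply: integrable_bmM => //; exact: bm_cst.
- exact: integrable_weight.
move=> x _; rewrite /weight/balanced_weight indicE.
case: (boolP (x \in D)) => [/set_mem Dx|_]; last by rewrite mulr0 mul0r.
by rewrite mulr1 mul1r; exact: backward_target_ge.
Qed.

(** The strip meets [D] in measure at most [lam ^+ 3 / 2], and the weight is at most [20 / 89]. In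
    units of [lam ^+ 3] this gives [10 / 89], below a quarter of [80 / 111]. *)
Lemma weight_strip_le y : \int[nu]_x (weight x * \1_(strip lam y) x) <= (\int[nu]_x weight x) / 4.
Proof.
have lam_gt0 := lam0.
pose U := parallelogram (y.1 - lam / 8) (y.1 + lam / 8) (c2 - 200 * lam * c1) (200 * lam) (lam ^+ 2).
have mU : measurable U by exact: measurable_parallelogram.
have h : y.1 - lam / 8 <= y.1 + lam / 8 by lra.
have [i e] := Rintegral_indic_plane mU (plane_measure_parallelogram (c2 - 200 * lam * c1) (200 * lam) h (sqr_ge0 lam)).
apply: (@le_trans _ _ (\int[nu]_x (20 / 89 * \1_U x))).
  apply: le_Rintegral => //.
  - by apply: integrable_Mbm; [exact: integrable_weight|apply: bm_indic; exact: measurable_strip].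
  - by apply: integrable_bmM => //; exact: bm_cst.
  move=> x _; rewrite /weight/balanced_weight mulrAC mulrC; apply: ler_pM => //.
  - by apply: (posop_ge0 (positive_curve_average lam0 (@measurable_parabola R))) => z; rewrite indicE.
  - exact: backward_target_le.
  rewrite !indicE; case: (boolP (x \in D)) => [/set_mem [h1 h2]|_]; last by rewrite mul0r.
  case: (boolP (x \in strip lam y)) => [/set_mem|_]; last by rewrite mulr0.
  rewrite /strip/= ltr_norml => /andP[h3 h4].
  by rewrite mem_set ?mulr1//; split => //; apply/andP; split; lra.
rewrite RintegralZl// e; have := weight_integral_ge.
have := exprn_gt0 3 lam0; rewrite mulr2n !exprS expr0; nra.
Qed.

Section Two_step.
Context (f : plane -> R) (y : plane).
Hypothesis bf : bm f.
Hypothesis f0 : forall x, 0 <= f x.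
Hypothesis fD : forall x, ~ D x -> f x = 0.
Hypothesis Dy : D y.

(** The integrand of the two-step kernel from [y]: a step of time [z.1] into [E], then a step back
    of time [z.2]. *)
Let G (z : line * line) : R :=
  k z.1 * \1_E (y + parabola z.1) * (k z.2 * f (y + parabola z.1 - parabola z.2)).

Let G_ge0 z : 0 <= G z.
Proof. by rewrite /G !mulr_ge0// ?kern_ge0// indicE. Qed.

Let mk : measurable_fun [set: line] (k : line -> R).
Proof. by apply/measurable_EFinP; exact: measurable_int (integrable_kern lam0). Qed.

Let mG : measurable_fun [set: line * line] G.
Proof.
have m1 : measurable_fun [set: line * line] (fun z : line * line => y + parabola z.1 : plane).
  exact: (measurableT_comp (measurable_along_curve (@measurable_parabola R) y) measurable_fst).
apply: measurable_funM.
  apply: measurable_funM; first exact: (measurableT_comp mk measurable_fst).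
  by apply: (measurableT_comp _ m1); exact: measurable_indic.
apply: measurable_funM; first exact: (measurableT_comp mk measurable_snd).
case: bf => mf _; apply: (measurableT_comp mf).
apply: (measurableT_comp (measurable_along_curve2 (@measurable_parabolaN R))
  (g := fun z : line * line => (y + parabola z.1 : plane, z.2))).
exact: measurable_fun_pair.
Qed.

Let mG2 : measurable_fun [set: line * line] (fun z : line * line => (G (z.1 + z.2, z.1))%:E).
Proof.
apply/measurable_EFinP; apply: (measurableT_comp mG).
by apply: measurable_fun_pair => //; exact: measurable_funD.
Qed.

(** Substituting [s = t + u] makes [u] the horizontal displacement; Tonelli makes it the outer
    variable, so that [t] moves the endpoint only vertically. *)
Let backward_forwardE :
  ((B (fun x => \1_E x * A f x) y)%:E = \int[mu]_u \int[mu]_t (G ((t + u)%R, t))%:E)%E.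
Proof.
have bA : bm (fun x => \1_E x * A f x).
  by apply: bmM; [exact: bm_indic|exact: bm_forward].
have iy := curve_integrand_integrable (integrable_kern lam0) (@measurable_parabola R) y bA.
transitivity (\int[mu]_s \int[mu]_t (G (s, t))%:E)%E.
  rewrite /backward {1}/curve_average {1}/Rintegral fineK; last exact: integrable_fin_num iy.
  apply: eq_integral => s _; rewrite mulrA EFinM /forward /curve_average /Rintegral.
  have i := curve_integrand_integrable (integrable_kern lam0) (@measurable_parabolaN R) (y + parabola s) bf.
  rewrite fineK; last exact: integrable_fin_num.
  by rewrite -integralZl.
have mGe : measurable_fun [set: line * line] (fun z : line * line => (G z)%:E).
  exact/measurable_EFinP.
have Ge0 (z : line * line) : (0 <= (G z)%:E)%E by rewrite lee_fin.
have Ge2 (z : line * line) : (0 <= (G ((z.1 + z.2)%R, z.1))%:E)%E by rewrite lee_fin.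
rewrite (fubini_tonelli _ mGe Ge0).
transitivity (\int[mu]_t \int[mu]_u (G ((t + u)%R, t))%:E)%E.
  apply: eq_integral => t _.
  have mt : measurable_fun [set: line] (fun s : line => (G (s, t))%:E).
    by apply/measurable_EFinP; apply: (measurableT_comp mG); exact: pair2_measurable.
  rewrite (ge0_integral_affine t (oner_neq0 R) mt)// normr1 mul1e.
  by apply: eq_integral => u _; rewrite mul1r.
exact: (fubini_tonelli _ mG2 Ge2).
Qed.

(** The minorization constant: [(4 lam)^-1] bounds the density [1 / (2 |u|)] from below for
    [|u| <= 2 lam], and each kernel contributes [(111 lam)^-1]. *)
Let cst0 : 0 <= (4 * lam)^-1 * (111 * lam)^-1 ^+ 2.
Proof. by rewrite mulr_ge0// ?sqr_ge0// invr_ge0 mulr_ge0// ltW. Qed.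

Let F (x : plane) : R := f x * \1_(~` strip lam y) x.

Let F_ge0 x : 0 <= F x. Proof. by rewrite mulr_ge0// indicE. Qed.

Let mF : measurable_fun [set: plane] F.
Proof.
case: bf => mf _; apply: measurable_funM => //; apply: measurable_indic.
by apply: measurableC; exact: measurable_strip.
Qed.

(* For fixed [u], [t |-> y.2 + u ^+ 2 + 2 * u * t] sweeps the vertical line
   through [y.1 + u] with constant speed [2 |u| <= 4 lam]. *)
Let slice u :
  (((4 * lam)^-1 * (111 * lam)^-1 ^+ 2)%:E * \int[mu]_v (F ((y.1 + u)%R, v))%:E <=
   \int[mu]_t (G ((t + u)%R, t))%:E)%E.
Proof.
have lam_gt0 := lam0.
(* For [|u| < lam / 8] the vertical line lies in the strip, for [|u| > 2 lam] it misses [D]; in both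
   cases [F] vanishes on it. *)
have [u1|u1] := ltP `|u| (lam / 8).
  rewrite (_ : (fun v => _) = cst 0%E) ?integral0 ?mule0.
    by apply: integral_ge0 => t _; rewrite lee_fin.
  apply/funext => v; rewrite /F indicE memNset ?mulr0//=.
  by rewrite /strip/= addrAC subrr add0r => /(_ u1).
have [u2|u2] := ltP (2 * lam) `|u|.
  rewrite (_ : (fun v => _) = cst 0%E) ?integral0 ?mule0.
    by apply: integral_ge0 => t _; rewrite lee_fin.
  apply/funext => v; rewrite /F fD ?mul0r// => -[/= /andP[h1 h2] _].
  have [/andP[d1 d2] _] := Dy.
  by move: u2; rewrite ltNge => /negP; apply; rewrite ler_norml; apply/andP; split; lra.
have u0 : u != 0 by apply/eqP => u0; move: u1; rewrite u0 normr0; lra.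
have v0 : 2 * u != 0 by rewrite mulf_neq0.
have mFu : measurable_fun setT (fun v : line => (F (y.1 + u, v))%:E).
  apply/measurable_EFinP; apply: (measurableT_comp mF); exact: pair1_measurable.
have Fe0 (v : line) : (0 <= (F ((y.1 + u)%R, v))%:E)%E by rewrite lee_fin.
rewrite (ge0_integral_affine (y.2 + u ^+ 2) v0 mFu Fe0).
have mFt : measurable_fun setT (fun t : line => (F (y.1 + u, y.2 + u ^+ 2 + 2 * u * t))%:E).
  apply: (measurableT_comp mFu (g := fun t : line => y.2 + u ^+ 2 + 2 * u * t)).
  exact: measurable_affine.
have k0 : (0 <= ((4 * lam)^-1 * (111 * lam)^-1 ^+ 2 * `|2 * u|)%:E)%E.
  by rewrite lee_fin mulr_ge0.
rewrite muleA -EFinM -ge0_integralZl//.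
apply: ge0_le_integral => //.
- by move=> t _; rewrite -EFinM lee_fin; apply: mulr_ge0 => //; exact: mulr_ge0.
- exact: emeasurable_funM.
- apply/measurable_EFinP; apply: (measurableT_comp mG).
  by apply: measurable_fun_pair => //; exact: measurable_funD.
move=> t _; rewrite -EFinM lee_fin.
pose z : plane := (y.1 + u, y.2 + u ^+ 2 + 2 * u * t).
have zE : y + parabola (t + u) - parabola t = z.
  by rewrite /z /parabola; case: y => y1 y2; congr (_, _) => /=; ring.
apply: (@le_trans _ _ ((111 * lam)^-1 ^+ 2 * f z)).
  apply: ler_pM => //.
    rewrite mulrAC ler_piMl ?sqr_ge0// mulrC ler_pdivrMr ?mulr_gt0// mul1r normrM gtr0_norm//; lra.
  by rewrite ler_piMr// indicE; case: (_ \in _).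
(* If the endpoint [z] is in [D], both times lie in the range of [kern] and the intermediate point
   lies in [E]. *)
have [Dz|nDz] := pselect (D z); last by rewrite fD// mulr0.
have uE : z.1 - y.1 = u by rewrite /z/= addrAC subrr add0r.
have uz : lam / 8 <= `|z.1 - y.1| by rewrite uE.
have tz : z.2 = y.2 + (z.1 - y.1) ^+ 2 + 2 * (z.1 - y.1) * t by rewrite uE.
have [/andP[t1 t2] /andP[t3 t4]] := two_step_times lam0 Dy Dz uz tz.
rewrite uE in t3 t4.
have Eyt : E (y + parabola (t + u)).
  apply: translate_in_target => //; have [/andP[d1 d2] _] := Dz.
  by rewrite /z/= in d1 d2; apply/andP; split; lra.
rewrite /G/= zE [\1_E _]indicE mem_set// mulr1 expr2 -mulrA.
apply: ler_pM => //.
- by rewrite invr_ge0 mulr_ge0// ltW.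
- by rewrite mulr_ge0// invr_ge0 mulr_ge0// ltW.
- by apply: kern_ge => //; apply/andP; split; lra.
- by apply: ler_wpM2r => //; apply: kern_ge => //; apply/andP; split; lra.
Qed.

(** Integrates [slice] over [u]; on the left, Tonelli and a translation of the first coordinate
    recover the plane integral. *)
Lemma two_step_minorization :
  (4 * lam)^-1 * (111 * lam)^-1 ^+ 2 * \int[nu]_x (f x * \1_(~` strip lam y) x) <=
  B (fun x => \1_E x * A f x) y.
Proof.
have iF : nu.-integrable setT (EFin \o F).
  have [i _] := Rintegral_indic_plane mD (source_measure c1 c2 lam0).
  have bF : bm (fun x => f x * \1_(~` strip lam y) x).
    by apply: bmM => //; apply: bm_indic; apply: measurableC; exact: measurable_strip.
  have := integrable_bmM bF i; apply: eq_integrable => // x _ /=; congr (_%:E).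
  rewrite /F [in RHS]mulrC; case: (pselect (D x)) => [Dx|nD].
    by rewrite [\1_D x]indicE mem_set// mulr1 mulrC.
  by rewrite fD// mul0r mulr0 mul0r.
rewrite -lee_fin EFinM /Rintegral fineK; last exact: integrable_fin_num.
rewrite backward_forwardE.
have mFe : measurable_fun [set: line * line] (fun z : line * line => (F z)%:E).
  exact/measurable_EFinP.
have Fe0 (z : line * line) : (0 <= (F z)%:E)%E by rewrite lee_fin.
have Fe1 (t : line) : (0 <= \int[mu]_v (F (t, v))%:E)%E.
  by apply: integral_ge0 => v _; rewrite lee_fin.
rewrite [X in (_ * X <= _)%E](_ : _ = \int[mu]_u \int[mu]_v (F ((y.1 + u)%R, v))%:E)%E; last first.
  apply: (etrans (fubini_tonelli1 _ mFe Fe0)).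
  apply: (etrans (ge0_integral_affine y.1 (oner_neq0 R) (measurable_fun_fubini_tonelli_F _ mFe Fe0) Fe1)).
  by rewrite normr1 mul1e; apply: eq_integral => u _; rewrite mul1r.
have mS2 : measurable_fun setT (fun u : line => \int[mu]_v (F ((y.1 + u)%R, v))%:E)%E.
  apply: (measurable_fun_fubini_tonelli_F (fun x : line * line => (F ((y.1 + x.1)%R, x.2))%:E)).
    apply/measurable_EFinP; apply: (measurableT_comp mF).
    by apply: measurable_fun_pair => //; apply: measurable_funD.
  by move=> x; rewrite lee_fin.
rewrite -ge0_integralZl//.
apply: ge0_le_integral => //.
- by move=> u _; rewrite mule_ge0// ?lee_fin// integral_ge0// => v _; rewrite lee_fin.
- exact: emeasurable_funM.
- apply: (measurable_fun_fubini_tonelli_G (fun z : line * line => (G ((z.1 + z.2)%R, z.1))%:E)) => //.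
  by move=> z; rewrite lee_fin.
Qed.

End Two_step.

End Minorization.

(** * From a commutator bound to the mean oscillation of a real symbol *)

Section Oscillation.
Context (R : realType).
Local Notation mu := (@lebesgue_measure R).
Local Notation line := (measurableTypeR R).
Local Notation plane := (line * line)%type.
Local Notation nu := (@plane_measure R).
Local Notation bm := (@bounded_measurable _ plane R).
Context (c1 c2 lam : R).
Hypothesis lam0 : 0 < lam.
Local Notation D := (source c1 c2 lam).
Local Notation E := (target c1 c2 lam).
Local Notation A := (forward lam).
Local Notation B := (backward lam).
Local Notation w := (weight c1 c2 lam).
Context (b : R * R -> R) (N : R).
Hypothesis ib : nu.-integrable setT (EFin \o (b : plane -> R)).
Hypothesis commutator_bound : forall f : plane -> R,
  measurable_fun setT f -> (forall x, `|f x| <= \1_D x) ->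
  \int[nu]_x (\1_E x * `|b x * A f x - A (fun y => b y * f y) x|) <= N.

Let mD : measurable D. Proof. exact: measurable_parallelogram. Qed.
Let mE : measurable E. Proof. exact: measurable_parallelogram. Qed.

Let iD : nu.-integrable setT (EFin \o (\1_D : plane -> R)).
Proof. exact: (Rintegral_indic_plane mD (source_measure c1 c2 lam0)).1. Qed.

Let duality (F g : R * R -> R) : nu.-integrable setT (EFin \o (F : plane -> R)) -> bm g ->
  nu.-integrable setT (EFin \o (fun x : plane => g x * A F x)) /\
  \int[nu]_x (g x * A F x) = \int[nu]_y (F y * B g y).
Proof.
apply: curve_average_duality; [exact: integrable_kern|exact: kern_ge0|
  exact: measurable_parabola|exact: measurable_parabolaN].
Qed.

(** Duality moves [B] from [g] onto [b * f], so the form becomes the integral of [g] against the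
    commutator applied to [f]. *)
Let pairing (f g : plane -> R) : measurable_fun setT f -> measurable_fun setT g ->
  (forall x, `|f x| <= \1_D x) -> (forall x, `|g x| <= \1_E x) ->
  `| \int[nu]_x (b x * (g x * A f x - f x * B g x)) | <= N.
Proof.
move=> mf mg fD gE.
have bf : bm f := bm_dominated mf (bm_indic R mD) fD.
have bg : bm g := bm_dominated mg (bm_indic R mE) gE.
have bA : bm (A f) by exact: bm_forward.
have ibf : nu.-integrable setT (EFin \o (fun y => b y * f y)) by exact: integrable_Mbm.
have [ig dg] := duality ibf bg.
have ibA : nu.-integrable setT (EFin \o (fun x => b x * (g x * A f x))).
  exact: (integrable_Mbm ib (bmM bg bA)).
have ibB : nu.-integrable setT (EFin \o (fun x => b x * f x * B g x)).
  exact: (integrable_Mbm ibf (bm_backward lam0 bg)).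
have -> : \int[nu]_x (b x * (g x * A f x - f x * B g x)) =
    \int[nu]_x (g x * (b x * A f x - A (fun y => b y * f y) x)).
  transitivity (\int[nu]_x (b x * (g x * A f x)) - \int[nu]_x (b x * f x * B g x)).
    by rewrite -RintegralB//; apply: eq_Rintegral => x _; ring.
  rewrite -dg -RintegralB//; apply: eq_Rintegral => x _.
  by ring.
have i1 : nu.-integrable setT (EFin \o (fun x => g x * (b x * A f x - A (fun y => b y * f y) x))).
  have := integrableB measurableT ibA ig; apply: eq_integrable => // x _.
  by rewrite /= -EFinB; congr (_%:E); ring.
apply: (le_trans (le_normr_Rintegral measurableT i1)).
apply: le_trans (commutator_bound mf fD).
apply: (le_Rintegral measurableT).
- exact: integrable_norm i1.
- have i2 : nu.-integrable setT (EFin \o (fun x => \1_E x * (b x * A f x - A (fun y => b y * f y) x))).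
    have [ig' _] := duality ibf (bm_indic R mE).
    have ibA' : nu.-integrable setT (EFin \o (fun x => b x * (\1_E x * A f x))).
      exact: (integrable_Mbm ib (bmM (bm_indic R mE) bA)).
    have := integrableB measurableT ibA' ig'; apply: eq_integrable => // x _.
    by rewrite /= -EFinB; congr (_%:E); ring.
  have := integrable_norm i2; apply: eq_integrable => // x _ /=; congr (_%:E).
  by rewrite normrM ger0_norm.
- by move=> x _; rewrite normrM ler_wpM2r.
Qed.

Lemma balanced_functional_le (phi : plane -> R) : measurable_fun setT phi ->
  (forall x, `|phi x| <= w x) -> \int[nu]_x phi x = 0 ->
  200^-1 * \int[nu]_x (b x * phi x) <= N *+ 2.
Proof.
have lam_gt0 := lam0.
apply: (@pairing_balanced _ plane R nu A B _ _ D E mD mE _ b N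
  ((4 * lam)^-1 * (111 * lam)^-1 ^+ 2) 200^-1 (2 / 89) (20 / 89) (strip lam)).
- exact: positive_curve_average (@measurable_parabolaN R).
- exact: positive_curve_average (@measurable_parabola R).
- by rewrite [X in (X < _)%E](source_measure c1 c2 lam0) ltry.
- exact: measurable_strip.
- exact: ib.
- move=> f g mf mg fD gE; apply: (duality _ _).2.
    by apply: (le_integrable measurableT _ _ iD) => [|x _];
      [exact/measurable_EFinP|rewrite /= lee_fin (le_trans (fD x))// ler_norm].
  exact: bm_dominated mg (bm_indic R mE) gE.
- exact: pairing.
- exact: forward_source_le.
- exact: backward_target_le.
- by lra.
- by lra.
- by rewrite mulr_ge0// ?sqr_ge0// invr_ge0 mulr_ge0// ltW.
- move=> f y bf f0 fD Dy; exact: two_step_minorization.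
- by move=> y _; exact: weight_strip_le.
- by lra.
(* The powers of [lam] cancel, and it remains to see that [20 / (200 * 89)], about 0.00112, is at
   most [89 ^+ 2 / (4 * 111 ^+ 3)], about 0.00145. *)
- apply: (@le_trans _ _ ((20 / 89 * (2 / 89))^-1 * ((4 * lam)^-1 * (111 * lam)^-1 ^+ 2 * (80 / 111 * lam ^+ 3 / 2)))).
    have l0 : lam != 0 by rewrite gt_eqF.
    rewrite [X in _ <= X](_ : _ = 89 ^+ 2 / (4 * 111 ^+ 3)); last by field.
    by rewrite ler_pdivlMr//; lra.
  apply: ler_wpM2l; first by lra.
  apply: ler_wpM2l; first by rewrite mulr_ge0// ?sqr_ge0// invr_ge0 mulr_ge0// ltW.
  rewrite ler_pM2r//; exact: weight_integral_ge.
Qed.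

(** The functional is tested on the sign of [b - m] over [Q], recentred to integral zero and scaled
    into the ball. The constant is [4440 = 2 * 200 * 111 / 10]. *)
Lemma oscillation_le (Q : set plane) (q : R) : measurable Q -> Q `<=` D ->
  0 < q -> nu Q = q%:E ->
  \int[nu]_(x in Q) `|b x - q^-1 * \int[nu]_(x in Q) b x| <= 4440 * N.
Proof.
move=> mQ QD q0 nuQ; set m := q^-1 * _.
have [iQ eQ] := Rintegral_indic_plane mQ nuQ.
have restr (f : plane -> R) : \int[nu]_(x in Q) f x = \int[nu]_x (f x * \1_Q x).
  by rewrite Rintegral_mkcond patch_indic.
have mb : measurable_fun [set: plane] b by apply/measurable_EFinP; exact: measurable_int ib.
pose P : set plane := [set x | m <= b x].
have mP : measurable P.
  rewrite (_ : P = setT `&` (fun x : plane => m <= b x) @^-1` [set true]).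
    exact: measurable_fun_ler.
  by rewrite setTI; apply/seteqP; split.
pose s (x : plane) : R := 2 * \1_P x - 1.
have bs : bm s.
  by apply: bmB; [apply: bmM; [exact: bm_cst|exact: bm_indic]|exact: bm_cst].
have s1 x : `|s x| <= 1.
  rewrite /s indicE; case: (x \in P); rewrite ?mulr1 ?mulr0; first by rewrite ger0_norm; lra.
  by rewrite ler0_norm; lra.
have sb x : (b x - m) * s x = `|b x - m|.
  rewrite /s indicE; case: (boolP (x \in P)) => [/set_mem|/negP].
    by rewrite /P/= => h; rewrite ger0_norm; lra.
  by rewrite inE /P/= => /negP; rewrite -ltNge => h; rewrite ltr0_norm; lra.
have isQ : nu.-integrable setT (EFin \o (fun x => s x * \1_Q x)) by exact: integrable_bmM.
pose sm := q^-1 * \int[nu]_x (s x * \1_Q x).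
have sm1 : `|sm| <= 1.
  rewrite /sm normrM ger0_norm ?invr_ge0 ?(ltW q0)// mulrC ler_pdivrMr// mul1r -eQ.
  apply: (le_trans (le_normr_Rintegral measurableT isQ)); apply: le_Rintegral => //.
    exact: integrable_norm.
  by move=> x _; rewrite normrM (ger0_norm (_ : 0 <= \1_Q x)) ?ler_piMl ?indicE.
(* The factor [10 / 111] fits [|s - sm| <= 2] under the weight, which is at least [20 / 111] on
   [D]. *)
pose phi (x : plane) : R := 10 / 111 * ((s x - sm) * \1_Q x).
have bphi : bm phi.
  apply: bmM; first exact: bm_cst.
  by apply: bmM; [apply: bmB => //; exact: bm_cst|exact: bm_indic].
have phiw x : `|phi x| <= w x.
  rewrite /phi /weight/balanced_weight [\1_D x]indicE [\1_Q x]indicE.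
  case: (boolP (x \in Q)) => [/set_mem Qx|_].
    rewrite mem_set/=; last exact: QD.
    rewrite mulr1 mul1r; apply: (@le_trans _ _ (20 / 111)); last first.
      by apply: backward_target_ge => //; exact: QD.
    have h : `|s x - sm| <= 2.
      by apply: (le_trans (ler_normB _ _)); have := s1 x; have := sm1; lra.
    rewrite normrM ger0_norm; last by lra.
    by lra.
  rewrite !mulr0 normr0 mulr_ge0//.
  by apply: (posop_ge0 (positive_curve_average lam0 (@measurable_parabola R))) => z; rewrite indicE.
have isB : nu.-integrable setT (EFin \o (fun x => (s x - sm) * \1_Q x)).
  by apply: integrable_bmM => //; apply: bmB => //; exact: bm_cst.
have qI : \int[nu]_x (s x * \1_Q x) = sm * q by rewrite /sm mulrAC mulVf ?mul1r// gt_eqF.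
have ismQ : nu.-integrable setT (EFin \o (fun x => sm * \1_Q x)).
  by apply: integrable_bmM => //; exact: bm_cst.
have phi0 : \int[nu]_x phi x = 0.
  rewrite /phi RintegralZl// (_ : \int[nu]_x ((s x - sm) * \1_Q x) = 0) ?mulr0//.
  under eq_Rintegral do rewrite mulrBl.
  by rewrite RintegralB// RintegralZl// eQ qI subrr.
have ibQ : nu.-integrable setT (EFin \o (fun x => b x * \1_Q x)).
  by apply: integrable_Mbm => //; exact: bm_indic.
have mq : \int[nu]_x (b x * \1_Q x) = m * q.
  by rewrite /m restr mulrAC mulVf ?mul1r// gt_eqF.
have ibm : nu.-integrable setT (EFin \o (fun x => (b x - m) * \1_Q x)).
  have imQ : nu.-integrable setT (EFin \o (fun x => m * \1_Q x)).
    by apply: integrable_bmM => //; exact: bm_cst.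
  have := integrableB measurableT ibQ imQ; apply: eq_integrable => // x _.
  by rewrite /= -EFinB; congr (_%:E); ring.
have ibms : nu.-integrable setT (EFin \o (fun x => (b x - m) * \1_Q x * s x)).
  exact: integrable_Mbm.
(* The terms [m * s] and [sm * b] both integrate over [Q] to [m * sm * q] and cancel, leaving
   [(b - m) * s = |b - m|]. *)
have key : \int[nu]_x (b x * phi x) = 10 / 111 * \int[nu]_(x in Q) `|b x - m|.
  have -> : \int[nu]_x (b x * phi x) = 10 / 111 * \int[nu]_x ((b x - m) * \1_Q x * s x +
     (m * (s x * \1_Q x) - sm * (b x * \1_Q x))).
    rewrite -RintegralZl//.
      by apply: eq_Rintegral => x _; rewrite /phi; ring.
    have h1 : nu.-integrable setT (EFin \o (fun x => m * (s x * \1_Q x))).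
      by apply: integrable_bmM => //; exact: bm_cst.
    have h2 : nu.-integrable setT (EFin \o (fun x => sm * (b x * \1_Q x))).
      by apply: integrable_bmM => //; exact: bm_cst.
    exact: (integrableD measurableT ibms (integrableB measurableT h1 h2)).
  have h1 : nu.-integrable setT (EFin \o (fun x => m * (s x * \1_Q x))).
    by apply: integrable_bmM => //; exact: bm_cst.
  have h2 : nu.-integrable setT (EFin \o (fun x => sm * (b x * \1_Q x))).
    by apply: integrable_bmM => //; exact: bm_cst.
  congr (_ * _); rewrite RintegralD//; last exact: (integrableB measurableT h1 h2).
  rewrite RintegralB// !RintegralZl// qI mq.
  rewrite [X in _ + X](_ : _ = 0); last by ring.
  rewrite addr0 restr; apply: eq_Rintegral => x _.
  by rewrite -sb mulrAC.
have [mphi _] := bphi.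
have := balanced_functional_le mphi phiw phi0; rewrite key mulr2n.
lra.
Qed.

End Oscillation.

(** * From the operator norm to real-valued commutators *)

Section Lp.
Context d (T : measurableType d) (R : realType) (m : {measure set T -> \bar R}).

(* The integral of a nonnegative function is a supremum over the simple functions
   below it, so it is monotone without measurability. *)
Lemma ge0_le_integral_nonmeasurable (f g : T -> \bar R) :
  (forall x, 0 <= f x)%E -> (forall x, f x <= g x)%E ->
  (\int[m]_x f x <= \int[m]_x g x)%E.
Proof.
move=> f0 fg; have g0 x : (0 <= g x)%E by exact: le_trans (fg x).
rewrite !ge0_integralTE//; apply: ereal_sup_le => _ [h hf <-].
by exists h => // x; apply: le_trans (fg x).
Qed.

Lemma ge0_le_integral_nonmeasurable_in (D : set T) (f g : T -> \bar R) :
  (forall x, D x -> 0 <= f x)%E -> (forall x, D x -> f x <= g x)%E ->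
  (\int[m]_(x in D) f x <= \int[m]_(x in D) g x)%E.
Proof.
move=> f0 fg; rewrite integral_mkcond [leRHS]integral_mkcond.
apply: ge0_le_integral_nonmeasurable => x; rewrite !patchE; case: ifPn => // /set_mem.
  exact: f0.
exact: fg.
Qed.

Lemma le_poweR (x y : \bar R) (r : R) : 0 <= r -> (0 <= x)%E -> (x <= y)%E ->
  (x `^ r <= y `^ r)%E.
Proof.
move=> r0 x0 xy; apply: gt0_ler_poweR => //; rewrite in_itv/= leey andbT//.
exact: le_trans xy.
Qed.

Lemma le_Lnorm_nonmeasurable (p : R) (f g : T -> R) : 0 < p ->
  (forall x, `|f x| <= `|g x|) ->
  (Lnorm m p%:E (EFin \o f) <= Lnorm m p%:E (EFin \o g))%E.
Proof.
move=> p0 fg; rewrite unlock.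
apply: le_poweR; first by rewrite invr_ge0 ltW.
  by apply: integral_ge0 => x _; exact: poweR_ge0.
apply: ge0_le_integral_nonmeasurable => x; first exact: poweR_ge0.
by apply: le_poweR; [exact: ltW|exact: abse_ge0|rewrite lee_fin].
Qed.

Lemma Lnorm_indic (p r : R) (U : set T) : 0 < p -> measurable U -> m U = r%:E ->
  Lnorm m p%:E (EFin \o (\1_U : T -> R)) = (r `^ p^-1)%:E.
Proof.
move=> p0 mU Ur; rewrite unlock -poweR_EFin -Ur; congr (_ `^ _)%E.
rewrite -[in RHS](setIT U) -integral_indic//; apply: eq_integral => x _.
rewrite /= indicE; case: (x \in U); rewrite /= ?normr1 ?normr0 ?powR1//.
by rewrite powR0// gt_eqF.
Qed.

(** Hölder's inequality against the indicator of [U], with conjugate exponent [(1 - p^-1)^-1]. *)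
Lemma integral_norm_le_Lnorm (p r : R) (f : T -> R) (U : set T) : 1 < p ->
  measurable U -> m U = r%:E -> measurable_fun setT f ->
  (\int[m]_x (\1_U x * `|f x|)%:E <= Lnorm m p%:E (EFin \o f) * (r `^ (1 - p^-1))%:E)%E.
Proof.
move=> p1 mU Ur mf; have p0 : 0 < p by exact: lt_trans p1.
have q0 : 0 < (1 - p^-1)^-1 by rewrite invr_gt0 subr_gt0 invf_lt1.
have := @hoelder _ _ _ m f \1_U p (1 - p^-1)^-1 mf (measurable_indic mU) p0 q0.
rewrite invrK addrC subrK => /(_ erefl); rewrite (Lnorm_indic q0 mU Ur) invrK Lnorm1.
apply: le_trans; rewrite le_eqVlt; apply/orP; left; apply/eqP; apply: eq_integral => x _.
by rewrite /= normrM mulrC (ger0_norm (_ : 0 <= \1_U x)).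
Qed.

End Lp.

(** * Principal values away from the singularity *)

Section Principal_value.
Context (R : realType).
Local Notation mu := (@lebesgue_measure R).
Local Notation line := (measurableTypeR R).
Local Notation plane := (line * line)%type.
Local Notation nu := (@plane_measure R).
Local Open Scope complex_scope.
Context (c1 c2 lam : R).
Hypothesis lam0 : 0 < lam.
Local Notation D := (source c1 c2 lam).
Local Notation E := (target c1 c2 lam).
Local Notation A := (forward lam).

Lemma complex_divr (z : R[i]) (t : R) : z / t%:C = (complex.Re z / t) +i* (complex.Im z / t).
Proof.
rewrite -fmorphV; case: z => u v /=.
by apply/eqP; rewrite eq_complex/= !mulr0 subr0 add0r !eqxx.
Qed.

(** Only times between [89 lam] and [111 lam] lead back from [E] to [D], so a truncation below
    [89 lam] removes nothing. The truncated integrals are thus eventually constant. *)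
Let truncated (g : R * R -> R) x eps : (forall y, ~ D y -> g y = 0) -> E x ->
  0 < eps < 89 * lam ->
  \int[mu]_(t in [set t | eps < `|t|]) (g (x - parabola t) / t) = A g x.
Proof.
move=> gD Ex /andP[e0 e1]; have lam_gt0 := lam0.
rewrite Rintegral_mkcond /forward /curve_average; apply: eq_Rintegral => t _.
have [Dx|nDx] := pselect (D (x - parabola t)); last first.
  by rewrite patchE (gD _ nDx) mul0r mulr0; case: ifP.
have /andP[t1 t2] := source_target_time Ex Dx.
have t0 : 0 < t by lra.
rewrite patchE mem_set/=; last by rewrite gtr0_norm//; lra.
rewrite /kern indicE mem_set/=; last by rewrite in_itv/= t1 t2.
by rewrite mul1r gtr0_norm// mulrC.
Qed.

Lemma pv_hilbert_kernel (g : R * R -> R[i]) x : (forall y, ~ D y -> g y = 0) -> E x ->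
  parabolic_hilbert g x =
  A (fun y => complex.Re (g y)) x +i* A (fun y => complex.Im (g y)) x.
Proof.
move=> gD Ex; have lam_gt0 := lam0.
have l89 : 0 < 89 * lam by lra.
have near0 : \forall eps \near (0 : R)^'+, 0 < eps < 89 * lam.
  near=> eps; apply/andP; split; near: eps; first exact: nbhs_right_gt.
  exact: nbhs_right_lt.
rewrite /parabolic_hilbert /pv; congr (_ +i* _).
- apply/cvg_lim => //; apply: cvg_near_cst; near=> eps.
  rewrite /truncated_integral /cintegral/= -(@truncated (fun y => complex.Re (g y)) x eps)//.
  + by apply: eq_Rintegral => t _; rewrite /hilbert_kernel complex_divr.
  + by move=> y /gD ->.
  + by near: eps.
- apply/cvg_lim => //; apply: cvg_near_cst; near=> eps.
  rewrite /truncated_integral /cintegral/= -(@truncated (fun y => complex.Im (g y)) x eps)//.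
  + by apply: eq_Rintegral => t _; rewrite /hilbert_kernel complex_divr.
  + by move=> y /gD ->.
  + by near: eps.
Unshelve. all: by end_near. Qed.

Lemma normr_Re_le (z : R[i]) : `|complex.Re z| <= Normc.normc z.
Proof. by case: z => u v /=; rewrite -sqrtr_sqr ler_sqrt ?lerDl ?sqr_ge0// addr_ge0 ?sqr_ge0. Qed.

Lemma normr_Im_le (z : R[i]) : `|complex.Im z| <= Normc.normc z.
Proof. by case: z => u v /=; rewrite -sqrtr_sqr ler_sqrt ?lerDr ?sqr_ge0// addr_ge0 ?sqr_ge0. Qed.

Lemma normc_le_Re_Im (z : R[i]) : Normc.normc z <= `|complex.Re z| + `|complex.Im z|.
Proof.
case: z => u v /=; rewrite -[leRHS]ger0_norm ?addr_ge0// -sqrtr_sqr ler_sqrt ?sqr_ge0//.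
rewrite sqrrD !real_normK ?num_real// addrAC lerDl.
by rewrite mulrn_wge0// mulr_ge0.
Qed.

(** A real [f] decouples the real and imaginary parts of [b], so the modulus of the complex
    commutator controls each of the two real ones. *)
Lemma hilbert_commutator_real (b : R * R -> R[i]) (f : R * R -> R) x :
  (forall y, ~ D y -> f y = 0) -> E x ->
  hilbert_commutator b (fun y => (f y)%:C) x =
  (complex.Re (b x) * A f x - A (fun y => complex.Re (b y) * f y) x) +i*
  (complex.Im (b x) * A f x - A (fun y => complex.Im (b y) * f y) x).
Proof.
move=> fD Ex; rewrite /hilbert_commutator !pv_hilbert_kernel//; last 2 first.
- by move=> y nD; rewrite fD// mulr0.
- by move=> y nD; rewrite fD.
have -> : A (fun y => complex.Im (f y)%:C) x = 0.
  have := posop0 (positive_curve_average lam0 (@measurable_parabolaN R)) x.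
  by [].
have -> : (fun y => complex.Re (b y * (f y)%:C)) = (fun y => complex.Re (b y) * f y).
  by apply/funext => y; case: (b y) => u v /=; rewrite mulr0 subr0.
have -> : (fun y => complex.Im (b y * (f y)%:C)) = (fun y => complex.Im (b y) * f y).
  by apply/funext => y; case: (b y) => u v /=; rewrite mulr0 add0r.
case: (b x) => u v /=; apply/eqP; rewrite eq_complex/= !mulr0 subr0 add0r.
by rewrite !eqxx.
Qed.

End Principal_value.

(** * Localizing the norm bound to the two regions *)

Section Lower_bound.
Context (R : realType) (p : R).
Hypothesis p1 : 1 < p.
Local Notation mu := (@lebesgue_measure R).
Local Notation line := (measurableTypeR R).
Local Notation plane := (line * line)%type.
Local Notation nu := (@plane_measure R).
Local Notation bm := (@bounded_measurable _ plane R).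
Local Open Scope complex_scope.
Context (b : R * R -> R[i]) (N : R).
Hypothesis b_loc : locally_integrable_plane b.
Hypothesis N0 : 0 <= N.
Hypothesis bound : forall f : plane -> R[i], in_Lp nu p f ->
  (cLnorm nu p (hilbert_commutator b f) <= N%:E * cLnorm nu p f)%E.

Section Component.
Context (c1 c2 lam : R) (beta : R * R -> R).
Hypothesis lam0 : 0 < lam.
Local Notation D := (source c1 c2 lam).
Local Notation E := (target c1 c2 lam).
Local Notation A := (forward lam).

(** A compact set containing both regions. Cutting the symbol off outside it gives an integrable
    function without changing the commutator between them. *)
Definition support_box : set (R * R) :=
  `[c1 - lam, c1 + 110 * lam]%classic `*`
  `[c2 - 3000 * lam ^+ 2, c2 + (100 * lam) ^+ 2 + 3000 * lam ^+ 2]%classic.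
Local Notation K := support_box.

Lemma source_sub_box : D `<=` K.
Proof.
have lam_gt0 := lam0; have l2 := sqr_ge0 lam.
move=> [y1 y2] [/= /andP[h1 h2]]; rewrite ler_norml => /andP[h3 h4].
have p1' : 0 <= lam * (lam - (y1 - c1)) by apply: mulr_ge0; lra.
have p2 : 0 <= lam * (lam + (y1 - c1)) by apply: mulr_ge0; lra.
by split; rewrite /= in_itv/=; apply/andP; split; nra.
Qed.

Lemma target_sub_box : E `<=` K.
Proof.
have lam_gt0 := lam0.
move=> [y1 y2] [/= /andP[h1 h2]]; rewrite ler_norml => /andP[h3 h4].
by split; rewrite /= in_itv/=; apply/andP; split; lra.
Qed.

Lemma compact_support_box : compact K.
Proof. by apply: compact_setX; exact: segment_compact. Qed.

Lemma measurable_support_box : measurable (K : set plane).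
Proof. by apply: measurableX; exact: measurable_itv. Qed.

Hypothesis beta_int : nu.-integrable K (fun x : plane => (beta x)%:E).
Hypothesis beta_le : forall f x, (forall y, ~ D y -> f y = 0) -> E x ->
  `|beta x * A f x - A (fun y => beta y * f y) x| <=
  Normc.normc (hilbert_commutator b (fun y => (f y)%:C) x).

Let betaK (x : plane) : R := beta x * \1_K x.

Lemma integrable_truncation : nu.-integrable setT (EFin \o betaK).
Proof.
have := (integrable_mkcond _ measurable_support_box).1 beta_int.
apply: eq_integrable => // x _; rewrite patchE /betaK/= indicE.
by case: (x \in K); rewrite ?mulr1 ?mulr0.
Qed.

Let mD : measurable D. Proof. exact: measurable_parallelogram. Qed.
Let mE : measurable E. Proof. exact: measurable_parallelogram. Qed.

(** Hölder on [E] and the norm bound give [N |D|^(1/p) |E|^(1 - 1/p)], which is at most [N |E|]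
    because [|D| <= |E|]; this removes [p] from the estimate. *)
Lemma truncated_commutator_le (f : plane -> R) : measurable_fun setT f ->
  (forall x, `|f x| <= \1_D x) ->
  \int[nu]_x (\1_E x * `|betaK x * A f x - A (fun y => betaK y * f y) x|) <=
  N * (120 * 1000 * lam ^+ 3).
Proof.
move=> mf fD.
have p0 : 0 < p by exact: lt_trans p1.
have fout y : ~ D y -> f y = 0.
  by move=> nD; have := fD y; rewrite indicE memNset// normr_le0 => /eqP.
have bf : bm f := bm_dominated mf (bm_indic R mD) fD.
have normf x : Normc.normc (f x)%:C = `|f x| by rewrite /= expr0n addr0 sqrtr_sqr.
have Lf : (cLnorm nu p (fun y => (f y)%:C) <= ((4 * lam ^+ 3) `^ p^-1)%:E)%E.
  rewrite -(Lnorm_indic p0 mD (source_measure c1 c2 lam0)).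
  apply: (@le_Lnorm_nonmeasurable _ _ _ nu p (fun y => Normc.normc (f y)%:C) \1_D p0) => x.
  by rewrite normf normr_id (le_trans (fD x))// ler_norm.
have fLp : in_Lp nu p (fun y => (f y)%:C).
  by split; [split=> //; exact: measurable_cst|exact: le_lt_trans Lf (ltry _)].
pose F (x : plane) : R := \1_E x * (betaK x * A f x - A (fun y => betaK y * f y) x).
have mbK : measurable_fun setT betaK.
  by apply/measurable_EFinP; exact: measurable_int integrable_truncation.
have mF : measurable_fun setT F.
  apply: measurable_funM; first exact: measurable_indic.
  apply: measurable_funB.
    by apply: measurable_funM => //; case: (bm_forward lam0 bf).
  apply: measurable_curve_average; [exact: integrable_kern|exact: measurable_parabolaN|].
  exact: measurable_funM.
have betaKf : (fun y => betaK y * f y) = (fun y => beta y * f y).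
  apply/funext => y; have [Dy|nD] := pselect (D y); last by rewrite fout// !mulr0.
  by rewrite /betaK indicE mem_set ?mulr1//; exact: source_sub_box.
have Fle x : `|F x| <= `|Normc.normc (hilbert_commutator b (fun y => (f y)%:C) x)|.
  rewrite /F indicE; case: (boolP (x \in E)) => [/set_mem Ex|_]; last by rewrite mul0r normr0.
  rewrite mul1r betaKf /betaK indicE mem_set ?mulr1; last exact: target_sub_box.
  by apply: (le_trans (beta_le fout Ex)); exact: ler_norm.
have LF : (Lnorm nu p%:E (EFin \o F) <= (N * (4 * lam ^+ 3) `^ p^-1)%:E)%E.
  apply: (le_trans (le_Lnorm_nonmeasurable nu p0 Fle)).
  apply: (le_trans (bound fLp)); rewrite EFinM.
  by apply: lee_wpmul2l => //; rewrite lee_fin.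
have H := integral_norm_le_Lnorm p1 mE (target_measure c1 c2 lam0) mF.
set r := 120 * 1000 * lam ^+ 3 in H *.
have l3 : 0 < lam ^+ 3 by exact: exprn_gt0.
have r0 : 0 < r by rewrite /r; lra.
have le1 : (\int[nu]_x (\1_E x * `|F x|)%:E <= (N * r)%:E)%E.
  apply: (le_trans H); apply: (@le_trans _ _ ((N * (4 * lam ^+ 3) `^ p^-1)%:E * (r `^ (1 - p^-1))%:E)%E).
    by apply: lee_wpmul2r => //; rewrite lee_fin powR_ge0.
  rewrite -EFinM lee_fin -mulrA ler_wpM2l//.
  apply: (@le_trans _ _ (r `^ p^-1 * r `^ (1 - p^-1))).
    rewrite ler_wpM2r ?powR_ge0//; apply: ge0_ler_powR.
    - by rewrite invr_ge0 ltW.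
    - by rewrite nnegrE; lra.
    - by rewrite nnegrE ltW.
    - by rewrite /r; lra.
  rewrite -powRD; last by apply/implyP => _; rewrite gt_eqF.
  by rewrite addrC subrK powRr1// ltW.
rewrite [leLHS](_ : _ = \int[nu]_x (\1_E x * `|F x|)); last first.
  apply: eq_Rintegral => x _; rewrite /F normrM mulrA indicE.
  by case: (x \in E); rewrite /= ?normr1 ?normr0 ?mulr1 ?mul0r.
rewrite /Rintegral -lee_fin fineK// ge0_fin_numE; first exact: le_lt_trans le1 (ltry _).
by apply: integral_ge0 => x _; rewrite lee_fin mulr_ge0// indicE.
Qed.

Lemma component_oscillation_le (Q : set plane) (q : R) : measurable Q -> Q `<=` D ->
  0 < q -> nu Q = q%:E ->
  (\int[nu]_(x in Q) (`|beta x - q^-1 * \int[nu]_(x in Q) beta x|)%:E <=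
   (4440 * (N * (120 * 1000 * lam ^+ 3)))%:E)%E.
Proof.
move=> mQ QD q0 nuQ.
have bKE x : Q x -> betaK x = beta x.
  by move=> Qx; rewrite /betaK indicE mem_set ?mulr1//; apply: source_sub_box; exact: QD.
have := oscillation_le lam0 integrable_truncation truncated_commutator_le mQ QD q0 nuQ.
have -> : \int[nu]_(x in Q) betaK x = \int[nu]_(x in Q) beta x.
  by apply: eq_Rintegral => x /set_mem Qx; exact: bKE.
set M := q^-1 * _.
rewrite (_ : \int[nu]_(x in Q) `|betaK x - M| = \int[nu]_(x in Q) `|beta x - M|); last first.
  by apply: eq_Rintegral => x /set_mem Qx; rewrite bKE.
rewrite -lee_fin; apply: le_trans; rewrite /Rintegral fineK//.
have iQ : nu.-integrable Q (EFin \o betaK).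
  by apply: integrableS integrable_truncation.
have iM : nu.-integrable Q (EFin \o (fun=> M)).
  apply: measurable_bounded_integrable => //; first by rewrite [X in (X < _)%E]nuQ ltry.
  exact: bounded_cst.
have i := integrableB mQ iQ iM.
have : nu.-integrable Q (EFin \o (fun x => `|beta x - M|)).
  have := integrable_abse i; apply: eq_integrable => // x /set_mem Qx /=.
  by rewrite bKE.
exact: integrable_fin_num.
Qed.

End Component.
End Lower_bound.

(** * Parabolic rectangles and the conclusion *)

Section Rectangles.
Context (R : realType) (p : R).
Hypothesis p1 : 1 < p.
Local Notation line := (measurableTypeR R).
Local Notation plane := (line * line)%type.
Local Notation nu := (@plane_measure R).
Local Open Scope complex_scope.

Lemma itv_bounds (s1 s2 : bool) (x u v : R) :
  x \in Interval (BSide s1 u) (BSide s2 v) -> u <= x <= v.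
Proof.
by rewrite in_itv/= => /andP[/lteifW h1 /lteifW h2]; apply/andP.
Qed.

Lemma mean_oscillation_le (b : R * R -> R[i]) (N : R) (Q : set (R * R)) :
  locally_integrable_plane b -> 0 <= N ->
  (forall f : plane -> R[i], in_Lp nu p f ->
    (cLnorm nu p (hilbert_commutator b f) <= N%:E * cLnorm nu p f)%E) ->
  @parabolic_rectangles R Q ->
  (mean_oscillation b Q <= (2 * 4440 * (120 * 1000 * 101 ^+ 3) * N)%:E)%E.
Proof.
move=> [mb b_loc] N0 bound [a1 [a2 [e1 [e2 [s1 [s2 [r1 [r2 [a12 e12 ea ->]]]]]]]]].
(* The factor 101 makes the rectangle fit into [source]: the vertical offset is at most [l ^+ 2 / 2
   + 200 * lam * l / 2 = 10100.5 l ^+ 2], below [lam ^+ 2 = 10201 l ^+ 2]. *)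
set Q' := _ `*` _; pose l := a2 - a1; pose lam := 101 * l.
pose c1 := (a1 + a2) / 2; pose c2 := (e1 + e2) / 2.
have l0 : 0 < l by rewrite subr_gt0.
have lam0 : 0 < lam by rewrite /lam; lra.
have mQ : measurable (Q' : set plane) by apply: measurableX; exact: measurable_itv.
have nuQ : nu Q' = (l ^+ 3)%:E.
  rewrite [LHS]product_measure1E; [|exact: measurable_itv|exact: measurable_itv].
  rewrite [X in (X * _)%E](lebesgue_measure_bounded_itv _ _ (ltW a12)).
  rewrite [X in (_ * X)%E](lebesgue_measure_bounded_itv _ _ (ltW e12)) -EFinM ea -/l.
  by congr (_%:E); ring.
have QD : Q' `<=` source c1 c2 lam.
  move=> [y1 y2] [/= /itv_bounds/andP[h1 h2] /itv_bounds/andP[h3 h4]].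
  rewrite -/l in ea.
  have d1 : `|y1 - c1| <= l / 2.
    by rewrite ler_norml /c1 /l; apply/andP; split; lra.
  have d2 : `|y2 - c2| <= l ^+ 2 / 2.
    by rewrite ler_norml -ea /c2; apply/andP; split; lra.
  split => /=.
    by move: d1; rewrite ler_norml /lam => /andP[? ?]; apply/andP; split; lra.
  move: d1 d2; rewrite !ler_norml => /andP[g1 g2] /andP[g3 g4].
  have k1 : 0 <= l * (l / 2 - (y1 - c1)) by apply: mulr_ge0; lra.
  have k2 : 0 <= l * (l / 2 + (y1 - c1)) by apply: mulr_ge0; lra.
  have k3 := sqr_ge0 l.
  by rewrite /lam; apply/andP; split; nra.
have [iRe iIm] := b_loc _ (@compact_support_box R c1 c2 lam).
have hRe f x : (forall y, ~ source c1 c2 lam y -> f y = 0) -> target c1 c2 lam x ->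
    `|complex.Re (b x) * forward lam f x - forward lam (fun y => complex.Re (b y) * f y) x| <=
    Normc.normc (hilbert_commutator b (fun y => (f y)%:C) x).
  move=> fD Ex; rewrite (hilbert_commutator_real lam0 b fD Ex).
  by apply: (le_trans _ (normr_Re_le _)).
have hIm f x : (forall y, ~ source c1 c2 lam y -> f y = 0) -> target c1 c2 lam x ->
    `|complex.Im (b x) * forward lam f x - forward lam (fun y => complex.Im (b y) * f y) x| <=
    Normc.normc (hilbert_commutator b (fun y => (f y)%:C) x).
  move=> fD Ex; rewrite (hilbert_commutator_real lam0 b fD Ex).
  by apply: (le_trans _ (normr_Im_le _)).
have q0 : 0 < l ^+ 3 by exact: exprn_gt0.
have oRe := component_oscillation_le p1 N0 bound lam0 iRe hRe mQ QD q0 nuQ.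
have oIm := component_oscillation_le p1 N0 bound lam0 iIm hIm mQ QD q0 nuQ.
have [mRe mIm] := mb.
have mean_Re : complex.Re (mean b Q') = (l ^+ 3)^-1 * \int[nu]_(x in Q') complex.Re (b x).
  by rewrite /mean nuQ /= mul0r subr0.
have mean_Im : complex.Im (mean b Q') = (l ^+ 3)^-1 * \int[nu]_(x in Q') complex.Im (b x).
  by rewrite /mean nuQ /= mul0r addr0.
rewrite /mean_oscillation nuQ/= lee_pdivrMl//.
set M := 4440 * (N * (120 * 1000 * lam ^+ 3)) in oRe oIm.
apply: (@le_trans _ _ (M%:E + M%:E)%E); last first.
  by rewrite -EFinD -EFinM lee_fin /M /lam; lra.
apply: le_trans (leeD oRe oIm); rewrite -ge0_integralD//; last 2 first.
- apply/measurable_EFinP; apply: measurableT_comp => //; apply: measurable_funB => //.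
  exact: measurable_funTS.
- apply/measurable_EFinP; apply: measurableT_comp => //; apply: measurable_funB => //.
  exact: measurable_funTS.
apply: ge0_le_integral_nonmeasurable_in => x _.
  rewrite lee_fin; apply: le_trans (normr_Re_le _) => //.
rewrite -EFinD lee_fin; apply: (le_trans (normc_le_Re_Im _)).
by rewrite -mean_Re -mean_Im; case: (b x) => u v; case: (mean b Q').
Qed.

End Rectangles.

Theorem theorem1p2 (R : realType) (p : R) (hp : 1 < p) :
  exists C : R, 0 < C /\
    forall b : R * R -> complex R, locally_integrable_plane b ->
      (BMO_norm b <= C%:E * commutator_norm p b)%E.
Proof.
(* The factor 2 counts the real and imaginary parts, 4440 comes from [oscillation_le], and the rest
   is the measure of [target] for [lam = 101 l] divided by that of the rectangle. *)
set C : R := 2 * 4440 * (120 * 1000 * 101 ^+ 3); exists C.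
have C0 : 0 < C by rewrite /C; lra.
split=> // b b_loc.
(* Dividing by [C] first lets the estimate be checked for each admissible bound [N]; with no such
   bound the infimum is [+oo]. *)
rewrite -lee_pdivrMl//; apply: le_ereal_inf_tmp => _ [N [N0 HN] <-].
rewrite lee_pdivrMl//; apply: ge_ereal_sup => _ [Q rQ <-].
rewrite -EFinM; apply: (mean_oscillation_le hp b_loc N0 _ rQ) => f fLp.
exact: (HN f fLp).2.
Qed.
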